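(* Let $x,H,k\geqslant1$ be integers and let $E(k)=2k^2+2$. Then \[\mathbb{E}_f\biggl|\frac{1}{\sqrt{H}}\sum_{x<n\leqslant x+H} f(n)\biggr|^{2k} = k! + O_k\biggl(H^{-1}+\frac{H^{1/2}}{\max(x,H)^{1/2}}+\frac{H\cdot(\log x+\log H)^{E(k)}}{\max(x,H)}\biggr),\] where the implied constant depends only on $k$.
   Context: $\mathcal{F}_{x+H}$ denotes the set of completely multiplicative functions $f:\{1,\dots,x+H\}\to\{|z|=1\}$, and $\mathbb{E}_f$ denotes expectation over $f\in\mathcal{F}_{x+H}$ with respect to the probability measure under which the values $f(p)$, $p\leqslant x+H$ prime, are independent and uniformly distributed on the unit circle (a Steinhaus random completely multiplicative function). *)

(* Defs.v *)
From HB Require Import structures.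
From mathcomp Require Import all_boot all_order all_algebra.
From mathcomp Require Import all_classical all_reals all_analysis.
From mathcomp Require Import complex.

Set Implicit Arguments.
Unset Strict Implicit.
Unset Printing Implicit Defensive.

Import Order.TTheory GRing.Theory Num.Theory.
Import numFieldNormedType.Exports.

Local Open Scope classical_set_scope.
Local Open Scope ring_scope.

(* The modulus of a complex number, as an element of R; the generic norm `|z|
   on R[i] is (normc z)%:C. *)
Definition cmod (R : realType) (z : R[i]) : R := ComplexField.Normc.normc z.

(* f restricted to {1, ..., N} is a completely multiplicative function with
   values in the unit circle; the values of f outside {1, ..., N} are junk.
   That f 1 = 1 follows, since f 1 = f 1 * f 1 and f 1 <> 0. *)
Definition unimodular_cmul (R : realType) (N : nat) (f : nat -> R[i]) : Prop :=
  (forall n : nat, (1 <= n <= N)%N -> cmod (f n) = 1) /\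
  (forall m n : nat, (1 <= m)%N -> (1 <= n)%N -> (m * n <= N)%N ->
     f (m * n)%N = f m * f n).

(* R[i] carries no sigma-algebra in the library: a complex random variable is
   observed through the Borel sets of R * R. *)
Definition complex_pair (R : realType) (z : R[i]) : R * R :=
  (complex.Re z, complex.Im z).

Definition is_complex_rv (R : realType) (d : measure_display)
    (T : measurableType d) (X : T -> R[i]) : Prop :=
  measurable_fun [set: T] (fun w => complex_pair (X w)).

(* The law of X is the normalized arc length on the unit circle, i.e. the image
   of Lebesgue measure on [0, 1] under t |-> exp(2 pi i t). *)
Definition uniform_on_circle (R : realType) (d : measure_display)
    (T : measurableType d) (P : probability T R) (X : T -> R[i]) : Prop :=
  forall A : set (R * R), measurable A ->
    P [set w | A (complex_pair (X w))] =
    lebesgue_measure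
      [set t : R | 0 <= t <= 1 /\ A (cos (2 * pi * t), sin (2 * pi * t))].

Definition mutually_independent (R : realType) (d : measure_display)
    (T : measurableType d) (P : probability T R) (I : eqType) (D : pred I)
    (X : I -> T -> R[i]) : Prop :=
  forall (J : seq I) (A : I -> set (R * R)),
    uniq J -> {subset J <= D} -> (forall i, measurable (A i)) ->
    P [set w | forall i, i \in J -> A i (complex_pair (X i w))] =
    (\prod_(i <- J) P [set w | A i (complex_pair (X i w))])%E.

(* f is a Steinhaus random completely multiplicative function on {1, ..., N}. *)
Definition steinhaus (R : realType) (d : measure_display)
    (T : measurableType d) (P : probability T R) (N : nat)
    (f : T -> nat -> R[i]) : Prop :=
  let primes_upto := [pred p : nat | prime p && (p <= N)%N] in
  [/\ forall w : T, unimodular_cmul N (f w),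
      forall p : nat, p \in primes_upto -> is_complex_rv (fun w => f w p),
      forall p : nat, p \in primes_upto ->
        uniform_on_circle P (fun w => f w p)
    & mutually_independent P primes_upto (fun p w => f w p)].

Definition Eexp (k : nat) : nat := (2 * k ^ 2 + 2)%N.

Definition error_term (R : realType) (x H k : nat) : R :=
  let M : R := (maxn x H)%:R in
  H%:R^-1 + Num.sqrt H%:R / Num.sqrt M
  + H%:R * (ln x%:R + ln H%:R) ^+ Eexp k / M.

(* Main.v *)
(** Expanding the 2k-th power and using orthogonality, the moment equals
    N / H^k, where N counts the pairs of k-tuples n, m in (x, x + H] with
    n_1 ... n_k = m_1 ... m_k.

    Orthogonality: the unit circle is cut into 2M arcs, each of probability
    1/(2M).  By independence all the configurations of arcs for the values
    f(p) are equiprobable, and replacing f(p) by the endpoint of its arc, a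
    2M-th root of unity, changes the moment by O(1/M); the average over roots
    of unity is exact once 2M > (x + H)^k.

    Counting: pairs with m a permutation of n contribute k! H^k + O(H^(k-1)).
    Removing common entries from the other pairs reduces to n_i <> m_j for all
    i, j.  Then n_1 = d_1 ... d_k with d_j | m_j, and d_j divides the nonzero
    number n_1 - m_j, so that d_j < H; summing over the multiples m_j of d_j
    gives H^k (H / x) up to divisor functions.  If H^(2k) < x^(2k-1) the bound
    tau(n) << n^eps suffices, and this is where sqrt(H / x) comes from.
    Otherwise let d_i be the largest of the d_j; short sums of divisor
    functions over the multiples of the other d_j lose only powers of
    logarithms, while for D = prod_(j <> i) d_j and e = m_i / d_i one has
    0 < |D - e| <= H D / x, so the pairs (D, e) contribute
    sum tau(D) tau(e) / D^2 << (H / x) sum tau(D)^2 / D. *)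
Require Import Defs.
From HB Require Import structures.
From mathcomp Require Import all_boot all_order all_algebra.
From mathcomp Require Import perm zify ring lra.

Set Implicit Arguments.
Unset Strict Implicit.
Unset Printing Implicit Defensive.

Import Order.TTheory GRing.Theory Num.Theory.

Local Open Scope ring_scope.

(** * Tuples with a prescribed product *)

Lemma leq_card_surj (A B : finType) (S : pred A) (C : pred B) (G : B -> A) :
  (forall a, S a -> exists2 b, C b & G b = a) -> (#|S| <= #|C|)%N.
Proof.
move=> SC; apply: leq_trans (leq_image_card G C).
apply: subset_leq_card; apply/subsetP => a /SC[b Cb <-].
by apply/imageP; exists b.
Qed.

Definition tprod B k (a : {ffun 'I_k -> 'I_B}) : nat := (\prod_i a i)%N.

(** For [0 < n < B] this is the [k]-fold divisor function, as the factors of [n] are then below [B];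
    for larger [n] only the factorizations with all entries below [B] are counted. *)
Definition tau B k n : nat := #|[pred a : {ffun 'I_k -> 'I_B} | tprod a == n]|.

Definition ins (T : Type) k (i : 'I_k.+1) (t : T) (a : {ffun 'I_k -> T}) :
    {ffun 'I_k.+1 -> T} :=
  [ffun j => if unlift i j is Some j' then a j' else t].

Lemma ins_eq T k i (t : T) (a : {ffun 'I_k -> T}) : ins i t a i = t.
Proof. by rewrite ffunE unlift_none. Qed.

Lemma ins_lift T k i (t : T) (a : {ffun 'I_k -> T}) j : ins i t a (lift i j) = a j.
Proof. by rewrite ffunE liftK. Qed.

Lemma ins_rest T k i (a : {ffun 'I_k.+1 -> T}) :
  ins i (a i) [ffun j => a (lift i j)] = a.
Proof. by apply/ffunP => j; rewrite ffunE; case: unliftP => [j'|] ->; rewrite ?ffunE. Qed.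

Lemma sum_ins (V : nmodType) (T : finType) k (i : 'I_k.+1)
    (P : pred {ffun 'I_k.+1 -> T}) (F : {ffun 'I_k.+1 -> T} -> V) :
  \sum_(a | P a) F a = \sum_(t : T) \sum_(a : {ffun 'I_k -> T} | P (ins i t a)) F (ins i t a).
Proof.
rewrite pair_big_dep /= (reindex (fun p : T * {ffun 'I_k -> T} => ins i p.1 p.2)) //=.
exists (fun a => (a i, [ffun j => a (lift i j)])) => [[t a] _|a _] /=.
  by rewrite ins_eq; congr (_, _); apply/ffunP => j; rewrite ffunE ins_lift.
exact: ins_rest.
Qed.

Lemma tprod_ins B k (i : 'I_k.+1) t (a : {ffun 'I_k -> 'I_B}) :
  tprod (ins i t a) = (t * tprod a)%N.
Proof.
rewrite /tprod (bigD1_ord i) //= ins_eq; congr (_ * _)%N.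
by apply: eq_bigr => j _; rewrite ins_lift.
Qed.

Lemma tprod_gt0 B k (a : {ffun 'I_k -> 'I_B}) :
  (0 < tprod a)%N -> forall i, (0 < a i)%N.
Proof. by move=> + i; rewrite /tprod (bigD1 i) //= muln_gt0 => /andP[]. Qed.

Lemma dvdn_tprod B k (a : {ffun 'I_k -> 'I_B}) i : (a i %| tprod a)%N.
Proof. by rewrite /tprod (bigD1 i) //= dvdn_mulr. Qed.

(** Greedy choice: the first factor is [gcdn n (m ord0)]. After division by it, [n] and [m ord0]
    become coprime, so by Gauss what remains of [n] divides the product of the other [m j]. *)
Lemma dvdn_prod_split l (n : nat) (m : 'I_l -> nat) : (0 < n)%N ->
  (n %| \prod_j m j)%N ->
  exists2 d : 'I_l -> nat, forall j, (d j %| m j)%N & (\prod_j d j)%N = n.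
Proof.
elim: l n m => [|l IH] n m n0.
  rewrite big_ord0 dvdn1 => /eqP ->; exists (fun=> 1%N); last by rewrite big_ord0.
  by case.
rewrite big_ord_recl => nm.
have g0 : (0 < gcdn n (m ord0))%N by rewrite gcdn_gt0 n0.
have ng := divnK (dvdn_gcdl n (m ord0)).
have [||d dm dn] := IH (n %/ gcdn n (m ord0))%N (fun j => m (lift ord0 j)).
- by rewrite divn_gt0 // dvdn_leq // dvdn_gcdl.
- have cop : coprime (n %/ gcdn n (m ord0)) (m ord0 %/ gcdn n (m ord0)).
    rewrite /coprime -(eqn_pmul2r g0) mul1n muln_gcdl.
    by rewrite !divnK ?dvdn_gcdl ?dvdn_gcdr.
  rewrite -(Gauss_dvdr _ cop) -(dvdn_pmul2r g0) ng.
  by rewrite mulnAC divnK ?dvdn_gcdr.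
exists (fun j => if unlift ord0 j is Some j' then d j' else gcdn n (m ord0)).
  by move=> j; case: unliftP => [j'|] ->; rewrite ?dvdn_gcdr.
rewrite big_ord_recl unlift_none -[RHS]ng mulnC; congr (_ * _)%N.
by rewrite -[RHS]dn; apply: eq_bigr => j _; rewrite liftK.
Qed.

(** The matrix is built row by row: [n ord0] divides the product of the [m j], hence splits along
    them, and the remaining rows refine the quotients. *)
Lemma prod_eq_refinement k l (n : 'I_k -> nat) (m : 'I_l -> nat) :
  (0 < \prod_i n i)%N -> (\prod_i n i = \prod_j m j)%N ->
  exists c : 'I_k -> 'I_l -> nat,
    (forall i, \prod_j c i j = n i)%N /\ (forall j, \prod_i c i j = m j)%N.
Proof.
elim: k n m => [|k IH] n m.
  rewrite big_ord0 => _ /esym/eqP; rewrite -dvdn1 => m1.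
  exists (fun _ _ => 1%N); split; first by case.
  move=> j; rewrite big_ord0; apply/esym/eqP; rewrite -dvdn1 (dvdn_trans _ m1) //.
  by rewrite (bigD1 j) //= dvdn_mulr.
rewrite big_ord_recl muln_gt0 => /andP[n0 n'0] nm.
have [|d dm dn] := @dvdn_prod_split l (n ord0) m n0.
  by rewrite -nm dvdn_mulr.
have [//||c [ci cj]] := IH (fun i => n (lift ord0 i)) (fun j => m j %/ d j)%N.
  apply/eqP; rewrite -(eqn_pmul2l n0) nm -[X in (X * _)%N]dn -big_split /=.
  by apply/eqP/eq_bigr => j _; rewrite mulnC divnK.
exists (fun i j => if unlift ord0 i is Some i' then c i' j else d j); split.
  move=> i; case: unliftP => [i'|] -> //; exact: ci.
move=> j; rewrite big_ord_recl unlift_none.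
rewrite (eq_bigr (fun i => c i j)); first by rewrite cj mulnC divnK.
by move=> i _; rewrite liftK.
Qed.

(** Every factorization of [m * n] is the entrywise product of one of [m] and one of [n], by
    [dvdn_prod_split]. The default in [insubd] covers products that reach [B]. *)
Lemma tau_mul B k m n : (0 < m)%N -> (0 < n)%N ->
  (tau B k (m * n) <= tau B k m * tau B k n)%N.
Proof.
move=> m0 n0; rewrite -cardX.
pose G (p : {ffun 'I_k -> 'I_B} * {ffun 'I_k -> 'I_B}) : {ffun 'I_k -> 'I_B} :=
  [ffun i => insubd (p.1 i) (p.1 i * p.2 i)%N].
apply: (@leq_card_surj _ _ _ _ G) => a /eqP aE.
have a0 : forall i, (0 < a i)%N by apply: tprod_gt0; rewrite aE muln_gt0 m0.
have [|d da dm] := @dvdn_prod_split k m (fun i => a i) m0.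
  by rewrite -/(tprod a) aE dvdn_mulr.
have dB i : (d i < B)%N by apply: leq_ltn_trans (ltn_ord (a i)); rewrite dvdn_leq.
have eB i : (a i %/ d i < B)%N by apply: leq_ltn_trans (leq_div _ _) (ltn_ord (a i)).
exists ([ffun i => Ordinal (dB i)], [ffun i => Ordinal (eB i)]).
  have bm : (\prod_i d i)%N = m by [].
  rewrite !inE /= /tprod; apply/andP; split.
    by under eq_bigr do rewrite ffunE /=; rewrite bm.
  under eq_bigr do rewrite ffunE /=.
  rewrite -(eqn_pmul2l m0) -aE -[X in (X * _)%N]bm -big_split /=; apply/eqP/eq_bigr => i _.
  by rewrite mulnC divnK.
apply/ffunP => i; rewrite /G !ffunE /=; apply: val_inj.
by rewrite val_insubd mulnC divnK // ltn_ord.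
Qed.

Lemma sum_ffun_prod (R : comPzSemiRingType) (T : finType) k (F : T -> R) :
  \sum_(a : {ffun 'I_k -> T}) \prod_i F (a i) = (\sum_t F t) ^+ k.
Proof. by rewrite -(bigA_distr_bigA (fun _ => F)) prodr_const card_ord. Qed.

Lemma sum_tprod (R : pzSemiRingType) B k (P : pred nat) (g : nat -> R) :
  (forall a : {ffun 'I_k -> 'I_B}, P (tprod a) -> (tprod a < B)%N) ->
  \sum_(a : {ffun 'I_k -> 'I_B} | P (tprod a)) g (tprod a) =
  \sum_(D : 'I_B | P D) (tau B k D)%:R * g D.
Proof.
move=> PB; transitivity (\sum_(a : {ffun 'I_k -> 'I_B} | P (tprod a))
    \sum_(D : 'I_B | P D && (tprod a == D :> nat)) g D).
  apply: eq_bigr => a Pa; rewrite (big_pred1 (Ordinal (PB a Pa))) // => D.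
  rewrite /= -val_eqE /= eq_sym; case: eqP => [->|]; rewrite ?andbF //.
  by rewrite Pa.
rewrite (exchange_big_dep (fun D : 'I_B => P D)) => [|a D _ /andP[]//] /=.
apply: eq_bigr => D PD; rewrite /tau -sum1_card natr_sum big_distrl /=.
under [RHS]eq_bigr do rewrite mul1r.
by apply: eq_bigl => a; rewrite inE PD /=; case: eqP => [->|]; rewrite ?PD ?andbF.
Qed.

(** Every tuple has a largest entry, so it occurs in some inner sum; ties are counted repeatedly,
    which nonnegativity allows. *)
Lemma sum_max (R : numDomainType) B k (P : pred {ffun 'I_k.+1 -> 'I_B})
    (F : {ffun 'I_k.+1 -> 'I_B} -> R) : (forall a, P a -> 0 <= F a) ->
  \sum_(a | P a) F a <= \sum_i \sum_(a | P a && [forall j, (a j <= a i)%N]) F a.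
Proof.
move=> F0; rewrite (exchange_big_dep P) => [|i a _ /andP[]//] /=.
apply: ler_sum => a Pa; pose i := [arg max_(i > ord0) (a i : nat)]%N.
rewrite (bigD1 i) /=; last first.
  rewrite Pa; apply/forallP => j; rewrite /i; case: arg_maxnP => // i' _ h.
  exact: h.
by rewrite lerDl sumr_ge0 // => j _; exact: F0.
Qed.

(** * Integers and multiples in short intervals *)

Lemma card_ord_interval B (P : pred 'I_B) lo w :
  (forall t, P t -> (lo <= t < lo + w)%N) -> (#|P| <= w)%N.
Proof.
case: w => [|w] Pw.
  by rewrite eq_card0 // => t; apply/negP => /Pw; rewrite addn0; lia.
rewrite -[leqRHS]card_ord; rewrite -(card_in_imset (f := fun t : 'I_B => inord (t - lo) : 'I_w.+1)) ?max_card //.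
move=> t u /Pw ht /Pw hu /(congr1 val) /=; rewrite !inordK; [|lia..].
by move=> ?; apply/val_inj => /=; lia.
Qed.

Lemma card_multiples B x H D : (0 < D)%N ->
  (#|[pred t : 'I_B | x < t * D <= x + H]| <= (H %/ D).+1)%N.
Proof.
move=> D0; apply: (@card_ord_interval _ _ (x %/ D).+1) => t /= /andP[h1 h2].
rewrite ltn_divLR // h1 /=.
have := divn_eq x D; have := divn_eq H D; have := ltn_pmod x D0; have := ltn_pmod H D0.
move=> a b c d; have e : (t * D < (x %/ D + H %/ D).+2 * D)%N by lia.
by move: e; rewrite ltn_pmul2r //; lia.
Qed.

(** The condition [D <= 2 * H] absorbs the extra 1 of [card_multiples]: [H + D <= 3 * H]. *)
Lemma card_multiples_le (R : realFieldType) B x H D : (0 < D <= 2 * H)%N ->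
  #|[pred t : 'I_B | (x < t * D <= x + H)%N]|%:R <= 3 * (H%:R / D%:R) :> R.
Proof.
move=> /andP[D0 DH]; rewrite mulrA ler_pdivlMr ?ltr0n //.
rewrite -!natrM ler_nat.
have := card_multiples B x H D0; rewrite -(leq_pmul2r D0) => /leq_trans -> //.
by have := leq_divM H D; lia.
Qed.

Lemma card_neighbours B (D s : nat) :
  (#|[pred e : 'I_B | [&& (e != D :> nat), (e <= D + s)%N & (D <= e + s)%N]]| <= 2 * s)%N.
Proof.
pose P1 := [pred e : 'I_B | D < e <= D + s]%N.
pose P2 := [pred e : 'I_B | (e < D) && (D <= e + s)]%N.
have h1 : (#|P1| <= s)%N by apply: (@card_ord_interval _ _ D.+1) => t /=; lia.
have h2 : (#|P2| <= s)%N by apply: (@card_ord_interval _ _ (D - s)%N) => t /=; lia.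
rewrite mul2n -addnn; apply: leq_trans (leq_add h1 h2).
rewrite -cardUI; apply: leq_trans (leq_addr _ _).
by apply: subset_leq_card; apply/subsetP => e; rewrite !inE; lia.
Qed.

(** The term [a = 0] vanishes because the inverse of 0 is 0, so for positive [B] this is the
    harmonic number of index [B - 1]. *)
Definition harm (R : realFieldType) B : R := \sum_(a < B) (a : nat)%:R^-1.

Lemma harm_ge0 (R : realFieldType) B : 0 <= harm R B.
Proof. by apply: sumr_ge0 => i _; rewrite invr_ge0. Qed.

Lemma sum_tprodV (R : realFieldType) B k :
  \sum_(a : {ffun 'I_k -> 'I_B}) (tprod a)%:R^-1 = harm R B ^+ k.
Proof.
rewrite -sum_ffun_prod; apply: eq_bigr => a _.
by rewrite natr_prod prodfV.
Qed.

Lemma sum_tau_le (R : realFieldType) B k (g : nat -> R) : (forall n, 0 <= g n) ->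
  \sum_(D : 'I_B) (tau B k D)%:R * g D <= \sum_(a : {ffun 'I_k -> 'I_B}) g (tprod a).
Proof.
move=> g0; have := @sum_tprod R B k (fun n => (n < B)%N) g (fun _ h => h).
rewrite [X in _ = X -> _](eq_bigl xpredT) => [<-|D]; last exact: ltn_ord.
by rewrite [leRHS](bigID (fun a => (tprod a < B)%N)) /= lerDl sumr_ge0.
Qed.

Lemma tau1 B k : (tau B k 1 <= 1)%N.
Proof.
apply/card_le1_eqP => a b /= /eqP ha /eqP hb; apply/ffunP => i; apply/val_inj => /=.
have := dvdn_tprod a i; have := dvdn_tprod b i.
by rewrite ha hb !dvdn1 => /eqP -> /eqP ->.
Qed.

Lemma tau_prod_le B k l (a : 'I_l -> nat) : (0 < \prod_i a i)%N ->
  (tau B k (\prod_i a i) <= \prod_i tau B k (a i))%N.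
Proof.
elim: l a => [|l IH] a; first by rewrite !big_ord0 tau1.
rewrite !big_ord_recl muln_gt0 => /andP[h1 h2].
by apply: leq_trans (tau_mul _ _ h1 h2) _; rewrite leq_mul // IH.
Qed.

(** One factor [tau B k D] is opened into a sum over tuples with product [D]; submultiplicativity
    bounds the other by the product of the [tau B k (a i)]. The sum then factors as a [k]-th
    power. *)
Lemma sum_tau_sqr (R : realFieldType) B k :
  \sum_(D : 'I_B) (tau B k D)%:R ^+ 2 / (D : nat)%:R <= harm R B ^+ (k * k).
Proof.
have s1 : \sum_(D : 'I_B) (tau B k D)%:R / (D : nat)%:R <= harm R B ^+ k.
  apply: le_trans (sum_tau_le B k (g := fun n => n%:R^-1) _) _.
    by move=> n; rewrite invr_ge0.
  by rewrite sum_tprodV.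
under eq_bigr do rewrite expr2 -mulrA.
apply: le_trans (sum_tau_le B k (g := fun n => (tau B k n)%:R / n%:R) _) _.
  by move=> n; rewrite divr_ge0.
rewrite exprM; apply: (@le_trans _ _ ((\sum_(D : 'I_B) (tau B k D)%:R / (D : nat)%:R) ^+ k)).
  rewrite -sum_ffun_prod; apply: ler_sum => a _.
  have [->|a0] := posnP (tprod a).
    by rewrite invr0 mulr0 prodr_ge0 // => i _; rewrite divr_ge0.
  rewrite big_split /= prodfV -!natr_prod ler_wpM2r ?invr_ge0 ?ler0n //.
  by rewrite ler_nat tau_prod_le.
apply: lerXn2r; rewrite ?nnegrE ?exprn_ge0 ?harm_ge0 // sumr_ge0 // => i _.
by rewrite divr_ge0.
Qed.

Lemma natr_card (R : pzSemiRingType) (T : finType) (P : pred T) :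
  #|P|%:R = \sum_(a | P a) 1 :> R.
Proof. by rewrite -sum1_card natr_sum. Qed.

Lemma tprod_le_exp B k (a : {ffun 'I_k -> 'I_B}) t :
  (forall j, (a j <= t)%N) -> (tprod a <= t ^ k)%N.
Proof. by move=> h; rewrite -[k in leqRHS]card_ord -prod_nat_const leq_prod. Qed.

Lemma leq_exp2rW m n e : (m <= n)%N -> (m ^ e <= n ^ e)%N.
Proof. by case: e => // e; rewrite leq_exp2r. Qed.

Lemma ins_max B k (i : 'I_k.+1) (t : 'I_B) a :
  [forall j, (ins i t a j <= ins i t a i)%N] -> forall j, (a j <= t)%N.
Proof. by move=> /forallP h j; have := h (lift i j); rewrite ins_lift ins_eq. Qed.

(** Extraction of a [2K]-th root: [H] is at least x^(1 - 1/(2K)), and [m] at most (2x)^(1 -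
    1/(2K)). *)
Lemma leq_of_exp_large (m H x K : nat) : (0 < K)%N -> (0 < x)%N ->
  (x ^ (2 * K).-1 <= H ^ (2 * K))%N -> (m ^ (2 * K) <= (2 * x) ^ (2 * K).-1)%N ->
  (m <= 2 * H)%N.
Proof.
move=> K0 x0 xH mx; rewrite leqNgt; apply/negP => Hm.
have : ((2 * H) ^ (2 * K) < (2 * x) ^ (2 * K).-1)%N.
  by apply: leq_trans mx; rewrite ltn_exp2r // muln_gt0 K0.
rewrite ltnNge => /negP; apply; rewrite !expnMn.
by apply: leq_mul; rewrite // leq_exp2l // leq_pred.
Qed.

(* Fixing all the factors of a but the largest leaves an interval of length
   H / (d b), where b, the product of the fixed factors, satisfies d b <= 2H. *)
Lemma card_tprod_multiples (R : realFieldType) x H B K (d : nat) :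
  (0 < x)%N -> (0 < d)%N -> (d * d <= 2 * x)%N -> (H <= x)%N ->
  (x ^ (2 * K.+1).-1 <= H ^ (2 * K.+1))%N ->
  #|[pred a : {ffun 'I_K.+1 -> 'I_B} | (x < d * tprod a <= x + H)%N]|%:R <=
  (3 * K.+1)%:R * (H%:R / d%:R) * harm R B ^+ K.
Proof.
move=> x0 d0 dx Hx xH; rewrite natr_card.
apply: le_trans (sum_max _) _ => [a _|]; first exact: ler01.
apply: (@le_trans _ _ (\sum_(i < K.+1) 3 * (H%:R / d%:R) * harm R B ^+ K)); last first.
  by rewrite sumr_const card_ord -mulr_natl natrM le_eqVlt; apply/orP; left; apply/eqP; ring.
apply: ler_sum => i _; rewrite (sum_ins i) (exchange_big_dep xpredT) //= -sum_tprodV mulr_sumr.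
apply: ler_sum => a _.
pose Q (t : 'I_B) := (x < d * tprod (ins i t a) <= x + H)%N &&
  [forall j, (ins i t a j <= ins i t a i)%N].
rewrite (eq_bigl Q) //.
have [t Qt|Q0] := pickP Q; last first.
  by rewrite big_pred0 // !mulr_ge0 ?invr_ge0.
have : forall t, Q t -> (x < t * (d * tprod a) <= x + H)%N.
  by move=> u; rewrite /Q tprod_ins mulnCA => /andP[].
move=> QQ; have /andP[t1 t2] := QQ _ Qt.
have at0 : (0 < t * (d * tprod a))%N by lia.
have [t0 a0] : (0 < t /\ 0 < tprod a)%N by move: at0; rewrite !muln_gt0 d0 => /and3P[].
have ta : (tprod a <= t ^ K)%N.
  by apply: tprod_le_exp; case/andP: Qt => _ /ins_max.
(* As [t] is the largest entry, [tprod a <= t ^ K], and [t * (d * tprod a) <= 2 * x]. So the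
   [K.+1]-th power of [d * tprod a] is at most [(2 * x) ^ K * d], and [d * d <= 2 * x] bounds the
   square of this. *)
have dH : (d * tprod a <= 2 * H)%N.
  apply: (leq_of_exp_large (ltn0Sn K) x0 xH).
  have h1 : ((d * tprod a) ^ K.+1 <= (2 * x) ^ K * d)%N.
    apply: (@leq_trans ((t * (d * tprod a)) ^ K * d)).
      rewrite !expnMn !expnS [X in (_ <= X)%N](_ : _ = d * d ^ K * (t ^ K * tprod a ^ K))%N; last by ring.
      by rewrite leq_mul // leq_mul.
    by apply: leq_mul => //; apply: leq_exp2rW; lia.
  rewrite [(2 * K.+1)%N]mulnC expnM; apply: (@leq_trans (((2 * x) ^ K * d) ^ 2)); first by rewrite leq_exp2r.
  rewrite expnMn -expnM -[(d ^ 2)%N]mulnn (_ : (K.+1 * 2).-1 = (K * 2).+1); last by lia.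
  by rewrite expnS mulnC leq_mul2r dx orbT.
apply: (@le_trans _ _ #|[pred t : 'I_B | (x < t * (d * tprod a) <= x + H)%N]|%:R).
  rewrite -natr_card ler_nat; apply: subset_leq_card; apply/subsetP => u.
  exact: QQ.
apply: le_trans (card_multiples_le _ _ _ _) _; first by rewrite muln_gt0 d0 a0.
by rewrite natrM invfM !mulrA.
Qed.

(** * Pairs of solutions without common entries *)

(** Both |D - e| < H D / x and |D - e| < H e / x, with denominators cleared and subtraction
    avoided. *)
Definition nearby x H D e : bool :=
  [&& (0 < D <= x + H)%N, (0 < e <= x + H)%N, D != e,
      (D * x < e * x + H * D)%N, (D * x < e * x + H * e)%N,
      (e * x < D * x + H * D)%N & (e * x < D * x + H * e)%N].

Lemma nearby_sym x H D e : nearby x H D e = nearby x H e D.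
Proof. by rewrite /nearby eq_sym; apply/idP/idP => /and5P[-> -> -> -> /and3P[-> -> ->]]. Qed.

Lemma card_nearby B x H D : (0 < x)%N ->
  (#|fun e : 'I_B => nearby x H D e| <= 2 * (H * D %/ x))%N.
Proof.
move=> x0; apply: leq_trans (card_neighbours B D (H * D %/ x)).
apply: subset_leq_card; apply/subsetP => e; rewrite !inE.
move=> /and5P[_ _ De h1 /and3P[_ h2 _]]; rewrite eq_sym De /=.
by rewrite -!leq_subLR !leq_divRL // !mulnBl; apply/andP; split; lia.
Qed.

(** With u(D) = (tau(D) / D)^2, the bound e <= 2D and 2ab <= a^2 + b^2 turn the summand into u(D) +
    u(e). The two halves agree by symmetry, and each [D] has at most 2HD/x neighbours, which leaves
    (H / x) tau(D)^2 / D. *)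
Lemma sum_nearby (R : realFieldType) B x H K : (0 < x)%N -> (H <= x)%N ->
  \sum_(D : 'I_B) \sum_(e : 'I_B | nearby x H D e)
     (tau B K D)%:R * (tau B K e)%:R / (D : nat)%:R ^+ 2
  <= 4 * (H%:R / x%:R) * harm R B ^+ (K * K).
Proof.
move=> x0 Hx; pose u (D : 'I_B) : R := ((tau B K D)%:R / (D : nat)%:R) ^+ 2.
have main : \sum_(D : 'I_B) \sum_(e : 'I_B | nearby x H D e) u D <=
    2 * (H%:R / x%:R) * harm R B ^+ (K * K).
  apply: le_trans (ler_wpM2l _ (sum_tau_sqr R B K)); last by rewrite mulr_ge0 ?divr_ge0.
  rewrite mulr_sumr; apply: ler_sum => D _; rewrite sumr_const -[_ *+ #|_|]mulr_natr.
  have [D0|] := eqVneq (D : nat) 0%N.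
    by rewrite /u D0 invr0 !mulr0 expr2 !mul0r.
  rewrite -lt0n => D0.
  apply: (@le_trans _ _ (u D * (2 * (H%:R * (D : nat)%:R / x%:R)))).
    rewrite ler_wpM2l ?sqr_ge0 //.
    apply: (@le_trans _ _ (2 * (H * D %/ x)%N%:R)).
      by rewrite -natrM ler_nat; exact: card_nearby.
    rewrite ler_pM2l ?ltr0n // ler_pdivlMr ?ltr0n // -!natrM ler_nat.
    exact: leq_divM.
  rewrite /u le_eqVlt; apply/orP; left; apply/eqP; field.
  by rewrite !pnatr_eq0 -!lt0n D0 x0.
apply: (@le_trans _ _ (\sum_(D : 'I_B) \sum_(e : 'I_B | nearby x H D e) (u D + u e))).
  apply: ler_sum => D _; apply: ler_sum => e /and5P[/andP[D0 _] /andP[e0 _] _ _ /and3P[_ h _]].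
  have eD : (e <= 2 * D)%N.
    rewrite -(leq_pmul2r x0) -mulnA mul2n -addnn; apply: leq_trans (ltnW h) _.
    by rewrite leq_add2l mulnC leq_mul2l Hx orbT.
  apply: (@le_trans _ _ (2 * ((tau B K D)%:R / (D : nat)%:R) * ((tau B K e)%:R / (e : nat)%:R))).
    have Dinv : (D : nat)%:R^-1 <= 2 * (e : nat)%:R^-1 :> R.
      by rewrite ler_pdivlMr ?ltr0n // mulrC ler_pdivrMr ?ltr0n // -natrM ler_nat.
    have := ler_wpM2l (_ : 0 <= (tau B K D)%:R * (tau B K e)%:R / (D : nat)%:R) Dinv.
    by rewrite expr2 invfM !mulrA => /(_ _)/le_trans -> //; [rewrite !mulr_ge0 ?invr_ge0|rewrite le_eqVlt; apply/orP; left; apply/eqP; ring].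
  rewrite /u; set a := _ / _; set b := _ / _.
  by rewrite -subr_ge0 (_ : _ - _ = (a - b) ^+ 2) ?sqr_ge0 //; ring.
under eq_bigr do rewrite big_split /=.
rewrite big_split /= [X in _ + X](exchange_big_dep xpredT) //=.
under [X in _ + X]eq_bigr do under eq_bigl do rewrite nearby_sym.
by lra.
Qed.

(** Here [v] stands for n_1 and [d * tprod a] for m_j; of the disjointness only m_j <> n_1 is
    kept. *)
Definition cofactors x H B K (d v : nat) : nat :=
  #|[pred a : {ffun 'I_K -> 'I_B} | (x < d * tprod a <= x + H)%N && (d * tprod a != v)%N]|.

(* d is the first row of a k x k matrix with row products n_i and column
   products m_j, and the j-th cofactor is the rest of its j-th column. *)
Definition incidence x H B K : nat :=
  (\sum_(d : {ffun 'I_K.+1 -> 'I_B} | x < tprod d <= x + H)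
     \prod_j cofactors x H B K (d j) (tprod d))%N.

Lemma cofactors_le x H B K d v :
  (cofactors x H B K d v <= #|[pred a : {ffun 'I_K -> 'I_B} | (x < d * tprod a <= x + H)%N]|)%N.
Proof. by apply: subset_leq_card; apply/subsetP => a; rewrite !inE => /andP[]. Qed.

Lemma sum_tprod_nearby (R : realFieldType) x H K : (0 < x)%N -> (H <= x)%N ->
  \sum_(d : {ffun 'I_K -> 'I_(x + H).+1})
    \sum_(a : {ffun 'I_K -> 'I_(x + H).+1} | nearby x H (tprod d) (tprod a)) (tprod d)%:R ^- 2
  <= 4 * (H%:R / x%:R) * harm R (x + H).+1 ^+ (K * K).
Proof.
move=> x0 Hx; apply: le_trans (sum_nearby _ _ _ x0 Hx).
pose g D : R := \sum_(a : {ffun 'I_K -> 'I_(x + H).+1} | nearby x H D (tprod a)) D%:R ^- 2.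
rewrite (bigID (fun d => (tprod d < (x + H).+1)%N)) /= [X in _ + X]big1 ?addr0; last first.
  move=> d; rewrite ltnS => /negbTE dB; apply: big1 => a.
  by rewrite /nearby dB andbF.
rewrite (@sum_tprod R (x + H).+1 K (fun n => (n < (x + H).+1)%N) g (fun _ h => h)).
rewrite [leLHS](eq_bigl xpredT) => [|D]; last exact: ltn_ord.
apply: ler_sum => D _; rewrite /g.
rewrite (@sum_tprod R _ K (fun e => nearby x H D e) (fun=> D%:R ^- 2)).
  by rewrite mulr_sumr; apply: ler_sum => e _; rewrite mulrA.
by move=> a /and5P[_ /andP[_ h] _ _ _].
Qed.

(** Multiply u (D - e) < H by [f] and use u f > x. Taking [f] to be [D] or [e], in both orders,
    gives the four inequalities of [nearby]. *)
Lemma close_factor x H u D e f : (0 < H)%N -> (0 < f)%N ->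
  (x < u * f)%N -> (u * D < u * e + H)%N -> (D * x < e * x + H * f)%N.
Proof.
move=> H0 f0 xf DeH; have [De|eD] := leqP D e.
  by apply: leq_ltn_trans (leq_mul De (leqnn x)) _; rewrite -[ltnLHS]addn0 ltn_add2l muln_gt0 H0.
have [m0 ->] : (0 < D - e /\ D = e + (D - e))%N by lia.
move: DeH; have -> : D = (e + (D - e))%N by lia.
move: (D - e)%N m0 => m m0; rewrite [(e + m - e)%N]addKn mulnDr ltn_add2l => umH.
rewrite mulnDl ltn_add2l; apply: (@leq_trans (m * (u * f))); first by rewrite ltn_pmul2l.
by rewrite mulnA [(m * u)%N]mulnC leq_mul2r (ltnW umH) orbT.
Qed.

(** Let [u] be the largest entry of the first row and [D] the product of the others. Each other
    column is counted by [card_tprod_multiples], for a total of order 1/D; the cofactor in the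
    column of [u] is near [D]; and [u] has O(H / D) values. What remains is the sum of 1/D^2 over
    nearby pairs. *)
Lemma incidence_long (R : realFieldType) x H K : (0 < x)%N -> (H <= x)%N ->
  (x ^ (2 * K.+2).-1 <= H ^ (2 * K.+2))%N ->
  (incidence x H (x + H).+1 K.+1)%:R <=
  12 * K.+2%:R * (3 * K.+1)%:R ^+ K.+1 * H%:R ^+ K.+2 * (H%:R / x%:R)
  * harm R (x + H).+1 ^+ (K * K.+1 + K.+1 * K.+1).
Proof.
move=> x0 Hx xH; set B := (x + H).+1.
(* The columns have one factor fewer; the condition passes down because [H ^ 2 <= x ^ 2]. *)
have xH' : (x ^ (2 * K.+1).-1 <= H ^ (2 * K.+1))%N.
  rewrite -(@leq_pmul2r (x ^ 2)) ?expn_gt0 ?x0 // -expnD.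
  rewrite (_ : (2 * K.+1).-1 + 2 = (2 * K.+2).-1)%N; last by lia.
  apply: leq_trans xH _; rewrite (_ : 2 * K.+2 = 2 * K.+1 + 2)%N; last by lia.
  by rewrite expnD leq_mul2l leq_exp2r // Hx orbT.
pose h := harm R B; have h0 : 0 <= h by exact: harm_ge0.
pose c1 : R := (3 * K.+1)%:R.
pose W : R := (c1 * H%:R * h ^+ K) ^+ K.+1 * (3 * H%:R).
have c10 : 0 <= c1 by rewrite ler0n.
have V0 : 0 <= (c1 * H%:R * h ^+ K) ^+ K.+1 by rewrite exprn_ge0 // !mulr_ge0 ?exprn_ge0.
have W0 : 0 <= W by rewrite mulr_ge0 // mulr_ge0.
rewrite natr_sum; apply: le_trans (sum_max _) _ => [d _|]; first by rewrite ler0n.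
apply: (@le_trans _ _ (\sum_(i < K.+2) (W * (4 * (H%:R / x%:R) * h ^+ (K.+1 * K.+1))))); last first.
  rewrite sumr_const card_ord -[_ *+ K.+2]mulr_natr le_eqVlt; apply/orP; left; apply/eqP.
  by rewrite /W exprD !exprMn -exprM -/c1 -/h [H%:R ^+ K.+2]exprS; ring.
apply: ler_sum => i _; rewrite (sum_ins i) (exchange_big_dep xpredT) //=.
apply: le_trans (ler_wpM2l _ (sum_tprod_nearby _ _ x0 Hx)) => //.
rewrite mulr_sumr; apply: ler_sum => d _; set D := tprod d.
pose Q (t : 'I_B) := (x < tprod (ins i t d) <= x + H)%N &&
  [forall j, (ins i t d j <= ins i t d i)%N].
rewrite (eq_bigl Q) //.
have [t Qt|Q0] := pickP Q; last first.
  by rewrite big_pred0 // mulr_ge0 // sumr_ge0 // => a _; rewrite invr_ge0 exprn_ge0.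
have QI u : Q u -> (x < u * D <= x + H)%N by rewrite /Q tprod_ins => /andP[].
have Qm u : Q u -> forall j, (d j <= u)%N by rewrite /Q => /andP[_ /ins_max].
have D0 : (0 < D)%N by have := QI _ Qt; rewrite [D]lock; case: (locked D) => //; lia.
(* [D] is a product of [K.+1] entries at most [t], so [D ^ K.+2 <= (t * D) ^ K.+1]. *)
have DH : (D <= 2 * H)%N.
  apply: (leq_of_exp_large (ltn0Sn K.+1) x0 xH).
  have /andP[t1 t2] := QI _ Qt.
  have h1 : (D ^ K.+2 <= (2 * x) ^ K.+1)%N.
    apply: (@leq_trans ((t * D) ^ K.+1)); last by apply: leq_exp2rW; lia.
    by rewrite expnMn expnS leq_mul // tprod_le_exp // => j; apply: Qm.
  rewrite [(2 * K.+2)%N]mulnC expnM; apply: (@leq_trans (((2 * x) ^ K.+1) ^ 2)).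
    by rewrite leq_exp2r.
  by rewrite -expnM leq_exp2l //; lia.
have dj u : Q u -> forall j, (d j * d j <= 2 * x)%N.
  move=> Qu j; have /andP[_ u2] := QI _ Qu.
  apply: (@leq_trans (u * D)); last by lia.
  by rewrite leq_mul ?Qm // dvdn_leq // dvdn_tprod.
apply: (@le_trans _ _ (\sum_(u | Q u) ((c1 * H%:R * h ^+ K) ^+ K.+1 / D%:R)
    * \sum_(a : {ffun 'I_K.+1 -> 'I_B} | (x < u * tprod a <= x + H)%N && (u * tprod a != u * D)%N) 1)).
  apply: ler_sum => u Qu; rewrite natr_prod (bigD1_ord i) //= ins_eq tprod_ins -/D mulrC.
  rewrite -natr_card; apply: ler_wpM2r; first exact: ler0n.
  apply: (@le_trans _ _ (\prod_(j < K.+1) (c1 * H%:R * h ^+ K / (d j)%:R))).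
    apply: ler_prod => j _; rewrite ler0n /= ins_lift.
    apply: le_trans (_ : (#|[pred a : {ffun 'I_K.+1 -> 'I_B} | (x < d j * tprod a <= x + H)%N]|)%:R <= _).
      by rewrite ler_nat cofactors_le.
    have dj0 : (0 < d j)%N by apply: tprod_gt0.
    apply: le_trans (card_tprod_multiples _ _ x0 dj0 (dj _ Qu j) Hx xH') _.
    by rewrite le_eqVlt; apply/orP; left; apply/eqP; rewrite /c1 /h; ring.
  by rewrite big_split /= prodr_const card_ord prodfV -natr_prod.
(* [u * D] and [u * tprod a] are distinct points of an interval of length [H], so [D] and [tprod a]
   are nearby. Once this is recorded, [u] only has to be counted. *)
rewrite -mulr_sumr (exchange_big_dep (fun a => nearby x H D (tprod a))) /=; last first.
  move=> u a Qu /andP[/andP[a1 a2] aD]; have /andP[u1 u2] := QI _ Qu.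
  have u0 : (0 < u)%N by case: (nat_of_ord u) u1.
  have a0 : (0 < tprod a)%N by case: (tprod a) a1; lia.
  have ne : D != tprod a by apply: contra aD => /eqP ->.
  have uDa : (u * D < u * tprod a + H /\ u * tprod a < u * D + H)%N by lia.
  have H0 : (0 < H)%N by lia.
  have [DB aB] : (D <= x + H /\ tprod a <= x + H)%N.
    by split; [apply: leq_trans u2|apply: leq_trans a2]; rewrite leq_pmull.
  rewrite /nearby D0 a0 ne DB aB /=.
  by apply/and4P; split; apply: (close_factor H0 _ _ _); eauto; lia.
rewrite [leRHS]mulr_sumr mulr_sumr; apply: ler_sum => a _.
apply: (@le_trans _ _ ((c1 * H%:R * h ^+ K) ^+ K.+1 / D%:R * (3 * (H%:R / D%:R)))).
  apply: ler_wpM2l; first by rewrite divr_ge0.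
  apply: le_trans (card_multiples_le R B x (_ : 0 < D <= 2 * H)%N); last by rewrite D0.
  rewrite -natr_card ler_nat; apply: subset_leq_card; apply/subsetP => u.
  by rewrite !inE => /andP[/QI].
by rewrite /W le_eqVlt; apply/orP; left; apply/eqP; field; rewrite pnatr_eq0 -lt0n.
Qed.

(** * Counting solutions of n_1 ... n_k = m_1 ... m_k *)

(** A second multiple of [d] besides [v] in the interval forces [d < H], so there are at most 3H/d
    multiples, each coming from at most [Y] tuples. *)
Lemma cofactors_short (R : realFieldType) x H K Y d v : (0 < x)%N -> (0 < d)%N ->
  (d %| v)%N -> (x < v <= x + H)%N ->
  (forall n, (0 < n <= x + H)%N -> (tau (x + H).+1 K n <= Y)%N) ->
  (cofactors x H (x + H).+1 K d v)%:R <= Y%:R * (3 * (H%:R / d%:R)) :> R.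
Proof.
move=> x0 d0 dv /andP[v1 v2] tauY; rewrite /cofactors natr_card.
pose Q n := (x < d * n <= x + H)%N && (d * n != v)%N.
rewrite (eq_bigl (fun a => Q (tprod a))) //.
have QB n : Q n -> (0 < n <= x + H)%N.
  move=> /andP[/andP[h1 h2] _]; rewrite (leq_trans _ h2) ?leq_pmull // andbT.
  by case: n h1 {h2}; lia.
rewrite (@sum_tprod R _ K Q (fun=> 1)) => [|a /QB/andP[]//].
have [e Qe|Q0] := pickP (fun e : 'I_(x + H).+1 => Q e); last first.
  by rewrite big_pred0 // !mulr_ge0 ?invr_ge0.
have dH : (0 < d <= 2 * H)%N.
  rewrite d0 /=; case/andP: Qe => /andP[h1 h2] ne.
  have [l|l] := ltnP v (d * e)%N.
    have : (d %| d * e - v)%N by rewrite dvdn_sub ?dvdn_mulr.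
    by move/dvdn_leq; lia.
  have : (d %| v - d * e)%N by rewrite dvdn_sub ?dvdn_mulr.
  by move/dvdn_leq; lia.
apply: le_trans (ler_wpM2l _ (card_multiples_le R (x + H).+1 x dH)) => //.
rewrite natr_card mulr_sumr [leRHS](bigID (fun e : 'I_(x + H).+1 => Q e)) /=.
apply: (@le_trans _ _ (\sum_(i < (x + H).+1 | (x < i * d <= x + H)%N && Q i) Y%:R * 1)).
  rewrite [leRHS](eq_bigl (fun e : 'I_(x + H).+1 => Q e)); last first.
    by move=> f; rewrite /Q mulnC; case: (x < _ <= _)%N.
  by apply: ler_sum => f /QB Qf; rewrite ler_wpM2r ?ler01 // ler_nat tauY.
by rewrite lerDl sumr_ge0 // => f _; rewrite mulr1.
Qed.

(** The columns contribute (3YH)^(K+1) / tprod d, and the sum of 1 / tprod d over the first rows is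
    a sum of tau(n) / n over the interval, at most Y H / x. *)
Lemma incidence_short (R : realFieldType) x H K Y : (0 < x)%N ->
  (forall n, (0 < n <= x + H)%N -> (tau (x + H).+1 K n <= Y)%N) ->
  (forall n, (0 < n <= x + H)%N -> (tau (x + H).+1 K.+1 n <= Y)%N) ->
  (incidence x H (x + H).+1 K)%:R <=
  3 ^+ K.+1 * Y%:R ^+ K.+2 * H%:R ^+ K.+1 * (H%:R / x%:R) :> R.
Proof.
move=> x0 Y1 Y2; rewrite natr_sum; set B := (x + H).+1.
apply: (@le_trans _ _ (\sum_(d : {ffun 'I_K.+1 -> 'I_B} | (x < tprod d <= x + H)%N)
   (3 * Y%:R * H%:R) ^+ K.+1 * (tprod d)%:R^-1)).
  apply: ler_sum => d xd; rewrite natr_prod.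
  have d0 : (0 < tprod d)%N by lia.
  apply: (@le_trans _ _ (\prod_(j < K.+1) (3 * Y%:R * H%:R / (d j)%:R))).
    apply: ler_prod => j _; rewrite ler0n /=.
    apply: le_trans (cofactors_short R x0 _ (dvdn_tprod d j) xd Y1) _; first exact: tprod_gt0.
    by rewrite le_eqVlt; apply/orP; left; apply/eqP; ring.
  by rewrite big_split /= prodr_const card_ord prodfV -natr_prod.
rewrite -mulr_sumr (@sum_tprod R _ K.+1 (fun n => (x < n <= x + H)%N) (fun n => n%:R^-1)); last first.
  by move=> a /andP[].
apply: (@le_trans _ _ ((3 * Y%:R * H%:R) ^+ K.+1 * (Y%:R * (H%:R / x%:R)))); last first.
  by rewrite !exprMn [Y%:R ^+ K.+2]exprS le_eqVlt; apply/orP; left; apply/eqP; ring.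
apply: ler_wpM2l; first by rewrite exprn_ge0 // !mulr_ge0.
apply: (@le_trans _ _ (\sum_(D < B | (x < D <= x + H)%N) Y%:R * x%:R^-1)).
  apply: ler_sum => D /andP[D1 D2]; apply: ler_pM; rewrite ?invr_ge0 ?ler0n //.
    by rewrite ler_nat Y2 //; lia.
  by rewrite lef_pV2 ?posrE ?ltr0n ?ler_nat; lia.
rewrite sumr_const -[_ *+ #|_|]mulr_natr -mulrA; apply: ler_wpM2l => //.
rewrite mulrC; apply: ler_wpM2r; first by rewrite invr_ge0.
by rewrite ler_nat; apply: (@card_ord_interval _ _ x.+1) => t; lia.
Qed.

Definition solution x H k (p : {ffun 'I_k -> 'I_(x + H).+1} * {ffun 'I_k -> 'I_(x + H).+1}) :=
  [&& [forall i, (x < p.1 i)%N], [forall i, (x < p.2 i)%N] & tprod p.1 == tprod p.2].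

Lemma solution_matrix x H k p : @solution x H k p ->
  exists2 c : {ffun 'I_k -> {ffun 'I_k -> 'I_(x + H).+1}},
    forall i, (\prod_j c j i)%N = p.1 i & forall j, tprod (c j) = p.2 j.
Proof.
case: p => n m /and3P[/= /forallP nx /forallP mx /eqP nm].
have m0 j : (0 < m j)%N by apply: leq_ltn_trans (mx j).
have n0 : (0 < tprod n)%N.
  by rewrite /tprod; apply: prodn_gt0 => i; apply: leq_ltn_trans (nx i).
have [c [c1 c2]] := prod_eq_refinement n0 nm.
have cB i j : (c i j < (x + H).+1)%N.
  apply: leq_ltn_trans (ltn_ord (m j)); apply: dvdn_leq; first exact: m0.
  by rewrite -c2 (bigD1 i) //= dvdn_mulr.
exists [ffun j => [ffun i => Ordinal (cB i j)]] => [i|j].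
  by rewrite -c1; apply: eq_bigr => j _; rewrite !ffunE.
by rewrite -c2; apply: eq_bigr => i _; rewrite !ffunE.
Qed.

(** A crude bound for the range x < H: the refinement matrix determines the solution, each of its
    [k] columns has product at most [x + H], and weighting by [(x + H) / tprod a >= 1] counts such
    columns. *)
Lemma card_solution_le (R : realFieldType) x H k :
  #|@solution x H k|%:R <= ((x + H)%:R * harm R (x + H).+1 ^+ k) ^+ k :> R.
Proof.
pose B := (x + H).+1; pose P := [pred a : {ffun 'I_k -> 'I_B} | (x < tprod a <= x + H)%N].
pose G (c : {ffun 'I_k -> {ffun 'I_k -> 'I_B}}) : {ffun 'I_k -> 'I_B} * {ffun 'I_k -> 'I_B} :=
  ([ffun i => inord (\prod_j c j i)], [ffun j => inord (tprod (c j))]).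
apply: (@le_trans _ _ ((#|P| ^ k)%N%:R)).
  have -> : (#|P| ^ k)%N = #|(ffun_on P : {pred {ffun 'I_k -> {ffun 'I_k -> 'I_B}}})| by rewrite card_ffun_on card_ord.
  rewrite ler_nat.
  apply: (@leq_card_surj _ _ _ _ G) => -[n m] /[dup] /and3P[/= /forallP nx /forallP mx _].
  move=> /solution_matrix[c /= c1 c2]; exists c.
    apply/ffun_onP => j; rewrite !inE c2 mx -ltnS; exact: ltn_ord.
  by congr (_, _); apply/ffunP => i; rewrite ffunE /= ?c1 ?c2 inord_val.
rewrite natrX; apply: lerXn2r; rewrite ?nnegrE ?ler0n ?mulr_ge0 ?exprn_ge0 ?harm_ge0 //.
rewrite natr_card -sum_tprodV mulr_sumr [leRHS](bigID P) /=.
rewrite -[leLHS]addr0 lerD ?sumr_ge0 // => [|a _]; last by rewrite mulr_ge0 ?invr_ge0.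
apply: ler_sum => a /andP[a1 a2]; rewrite ler_pdivlMr ?ltr0n ?mul1r ?ler_nat //.
exact: leq_ltn_trans a1.
Qed.

Definition disjoint_solution x H k p :=
  @solution x H k p && [forall i, forall j, p.1 i != p.2 j].

(** The refinement matrix of a disjoint solution is cut into its first row, of product n_1, and the
    remainders of its columns; these data determine the solution. *)
Lemma card_disjoint_solution x H K :
  (#|@disjoint_solution x H K.+1| <= incidence x H (x + H).+1 K)%N.
Proof.
pose B := (x + H).+1.
pose Q (d : {ffun 'I_K.+1 -> 'I_B}) (j : 'I_K.+1) := [pred a : {ffun 'I_K -> 'I_B} |
  (x < d j * tprod a <= x + H)%N && (d j * tprod a != tprod d)%N].
(* Each term of the sum counts the families of cofactors, one per column, over a fixed first row. *)
have -> : incidence x H B K = #|[pred q : {ffun 'I_K.+1 -> 'I_B} * {ffun 'I_K.+1 -> {ffun 'I_K -> 'I_B}} |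
    (x < tprod q.1 <= x + H)%N && (q.2 \in family (Q q.1))]|.
  rewrite -sum1_card /= -(pair_big_dep (fun d : {ffun 'I_K.+1 -> 'I_B} => (x < tprod d <= x + H)%N)
    (fun d q => q \in family (Q d)) (fun _ _ => 1%N)) /=.
  apply: eq_bigr => d _; rewrite -[LHS](eq_bigr _ (fun j _ => sum1_card (Q d j))).
  rewrite (bigA_distr_big_dep _ (fun j a => 1%N)).
  by apply: eq_bigr => f _; rewrite prod_nat_const exp1n.
pose G (q : {ffun 'I_K.+1 -> 'I_B} * {ffun 'I_K.+1 -> {ffun 'I_K -> 'I_B}}) :
    {ffun 'I_K.+1 -> 'I_B} * {ffun 'I_K.+1 -> 'I_B} :=
  ([ffun i => inord (if unlift ord0 i is Some i' then (\prod_j q.2 j i')%N else tprod q.1)],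
   [ffun j => inord (q.1 j * tprod (q.2 j))]).
apply: (@leq_card_surj _ _ _ _ G) => -[n m] /andP[/[dup] /and3P[/= /forallP nx /forallP mx _]].
move=> /solution_matrix[c /= c1 c2] /'forall_forallP nm.
pose d := [ffun j => c j ord0]; pose r := [ffun j => [ffun i => c j (lift ord0 i)]].
have dE : tprod d = n ord0 by rewrite -c1; apply: eq_bigr => j _; rewrite ffunE.
have rE j : (d j * tprod (r j))%N = m j.
  rewrite -c2 /tprod big_ord_recl !ffunE; congr (_ * _)%N.
  by apply: eq_bigr => i _; rewrite !ffunE.
exists (d, r).
  rewrite /= dE nx -ltnS ltn_ord /=; apply/familyP => j.
  by rewrite inE rE mx dE -ltnS ltn_ord /= eq_sym nm.
congr (_, _); apply/ffunP => i; rewrite ffunE /= ?rE ?inord_val //.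
case: unliftP => [i'|] ->; last by rewrite dE inord_val.
rewrite -[RHS]inord_val -c1; congr inord; apply: eq_bigr => j _.
by rewrite !ffunE.
Qed.

(** * Diagonal solutions, and removal of common entries *)

Lemma count_codom (T : eqType) k (P : pred T) (f : {ffun 'I_k -> T}) :
  count P (codom f) = (\sum_i P (f i))%N.
Proof. by rewrite -sum1_count /codom /image_mem big_map big_enum_cond /= big_mkcond. Qed.

Lemma perm_codom_ins (T : eqType) k i (t : T) (a : {ffun 'I_k -> T}) :
  perm_eq (codom (ins i t a)) (t :: codom a).
Proof.
apply/seq.permP => P; rewrite /= !count_codom (bigD1_ord i) //= ins_eq.
by congr (_ + _)%N; apply: eq_bigr => j _; rewrite ins_lift.
Qed.

Lemma perm_codom_exists (T : eqType) k (n m : {ffun 'I_k -> T}) :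
  perm_eq (codom m) (codom n) -> exists s : 'S_k, m = [ffun i => n (s i)].
Proof.
have cod (f : {ffun 'I_k -> T}) : codom f = [tuple f i | i < k] by rewrite codomE.
rewrite !cod => /tuple_permP[s E]; exists s; apply/ffunP => i; rewrite ffunE.
have /(congr1 (fun t => tnth t i)) : [tuple m i | i < k] = [tuple tnth [tuple n i | i < k] (s i) | i < k].
  exact: val_inj.
by rewrite !tnth_mktuple.
Qed.

Lemma perm_codom_perm (T : eqType) k (n : {ffun 'I_k -> T}) (s : 'S_k) :
  perm_eq (codom [ffun i => n (s i)]) (codom n).
Proof.
apply/seq.permP => P; rewrite !count_codom [RHS](reindex_inj (@perm_inj _ s)).
by apply: eq_bigr => i _; rewrite ffunE.
Qed.

Lemma tprod_perm B k (n m : {ffun 'I_k -> 'I_B}) :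
  perm_eq (codom n) (codom m) -> tprod n = tprod m.
Proof.
move=> /perm_codom_exists[s ->]; rewrite /tprod [RHS](reindex_inj (@perm_inj _ s)).
by apply: eq_bigr => i _; rewrite ffunE.
Qed.

Definition diag_solution x H k p :=
  @solution x H k p && perm_eq (codom p.1) (codom p.2).

Definition offdiag_solution x H k p :=
  @solution x H k p && ~~ perm_eq (codom p.1) (codom p.2).

Lemma card_short_interval x H : #|[pred t : 'I_(x + H).+1 | (x < t)%N]| = H.
Proof.
rewrite -sum1_card /= -(big_geq_mkord _ _ xpredT (fun=> 1%N)).
by rewrite sum_nat_const_nat muln1; lia.
Qed.

(** The difference counts the tuples with a repeated entry; in the induction,
    [k ^ 2 + k <= k.+1 ^ 2]. *)
Lemma expn_le_ffact H k : (H ^ k <= H ^_ k + k ^ 2 * H ^ k.-1)%N.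
Proof.
elim: k => [|k IH]; first by rewrite ffactn0.
rewrite ffactnSr expnS /=.
have h1 : (H * H ^ k <= H * H ^_ k + k ^ 2 * H ^ k)%N.
  apply: leq_trans (leq_mul (leqnn H) IH) _; rewrite mulnDr leq_add2l mulnCA leq_mul2l.
  by case: k {IH} => // k; rewrite /= -expnS leqnn ?orbT.
have h2 : (H ^_ k <= H ^ k)%N.
  by elim: k {IH h1} => // k IH; rewrite ffactnSr expnSr leq_mul // leq_subr.
have h3 : (H * H ^_ k <= H ^_ k * (H - k) + k * H ^_ k)%N.
  by rewrite mulnC [(k * _)%N]mulnC -mulnDr leq_mul2l; apply/orP; right; lia.
by nia.
Qed.

(** The map sending (n, s) to (n, n o s) reaches every diagonal solution, which gives the upper
    bound. It is injective over the [H ^_ k] tuples with distinct entries, which gives the lower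
    one. *)
Lemma card_diagonal x H k :
  (#|@diag_solution x H k| <= k`! * H ^ k)%N /\
  (k`! * H ^ k <= #|@diag_solution x H k| + k`! * (k ^ 2 * H ^ k.-1))%N.
Proof.
pose B := (x + H).+1; pose D := [pred t : 'I_B | (x < t)%N].
pose A := (ffun_on D : {pred {ffun 'I_k -> 'I_B}}).
pose F (q : {ffun 'I_k -> 'I_B} * 'S_k) := (q.1, [ffun i => q.1 (q.2 i)]).
have cA : #|A| = (H ^ k)%N by rewrite card_ffun_on card_short_interval card_ord.
have dF q : q.1 \in A -> diag_solution (F q).
  move=> /ffun_onP qA; apply/andP; split; last by rewrite perm_sym perm_codom_perm.
  apply/and3P; split; [apply/forallP => i; exact: qA..| |].
    by apply/forallP => i; rewrite ffunE; apply: qA.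
  by apply/eqP/tprod_perm; rewrite perm_sym perm_codom_perm.
split.
  have -> : (k`! * H ^ k)%N = #|[pred q : {ffun 'I_k -> 'I_B} * 'S_k | (q.1 \in A) && (q.2 \in 'S_k)]|.
    by rewrite -card_Sn -cA mulnC -cardX.
  apply: (@leq_card_surj _ _ _ _ F) => -[n m] /andP[/and3P[/= /forallP nx _ _]].
  rewrite perm_sym => /perm_codom_exists[s ->]; exists (n, s) => //=.
  by rewrite !inE andbT; apply/ffun_onP.
apply: leq_trans (leq_mul (leqnn _) (expn_le_ffact H k)) _.
rewrite mulnDr leq_add2r.
pose I := [pred f : {ffun 'I_k -> 'I_B} | (f \in A) && injectiveb f].
have cI : (H ^_ k = #|I|)%N.
  have := card_inj_ffuns_on 'I_k D; rewrite card_ord card_short_interval => <-.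
  by apply: eq_card => f; rewrite !inE.
have -> : (k`! * H ^_ k)%N = #|[pred q : {ffun 'I_k -> 'I_B} * 'S_k | (q.1 \in I) && (q.2 \in 'S_k)]|.
  by rewrite -card_Sn cI mulnC -cardX.
rewrite -(card_in_image (f := F)); last first.
  move=> [n s] [n' s'] /andP[/= /andP[_ /injectiveP ni] _] _ [nn' /ffunP]; rewrite -nn' => e.
  congr (_, _); apply/permP => i; apply: ni; by have := e i; rewrite !ffunE.
apply: subset_leq_card; apply/subsetP => p /imageP[q /andP[/andP[qA _] _] ->].
exact: dF.
Qed.

(** If the solution is not disjoint, some n_i = m_j. Deleting both leaves an off-diagonal solution
    of size [k]; there are [k.+1 ^ 2] positions and [H] common values. *)
Lemma card_offdiagonal_rec x H k :
  (#|@offdiag_solution x H k.+1| <=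
   #|@disjoint_solution x H k.+1| + k.+1 ^ 2 * (H * #|@offdiag_solution x H k|))%N.
Proof.
pose S i j := [pred p : {ffun 'I_k.+1 -> 'I_(x + H).+1} * {ffun 'I_k.+1 -> 'I_(x + H).+1}
  | offdiag_solution p && (p.1 i == p.2 j)].
have cS i j : (#|S i j| <= H * #|@offdiag_solution x H k|)%N.
  have -> : (H * #|@offdiag_solution x H k|)%N = #|[predX [pred t : 'I_(x + H).+1 | (x < t)%N] & @offdiag_solution x H k]|.
    by rewrite cardX card_short_interval.
  pose G (q : 'I_(x + H).+1 * ({ffun 'I_k -> 'I_(x + H).+1} * {ffun 'I_k -> 'I_(x + H).+1})) :=
    (ins i q.1 q.2.1, ins j q.1 q.2.2).
  apply: (@leq_card_surj _ _ _ _ G) => -[n m] /andP[/andP[/and3P[/= /forallP nx /forallP mx /eqP nm] np] /eqP ij].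
  exists (n i, ([ffun a => n (lift i a)], [ffun a => m (lift j a)])); last first.
    by rewrite /G /= ins_rest ij ins_rest.
  rewrite !inE /= nx /=; apply/andP; split.
    apply/and3P; split => /=; try by apply/forallP => a; rewrite ffunE ?nx ?mx.
    have ni0 : (0 < n i)%N by apply: leq_ltn_trans (nx i).
    rewrite -(eqn_pmul2l ni0) -(tprod_ins i) ins_rest ij -(tprod_ins j) ins_rest.
    by rewrite nm.
  apply: contra np => /= E; rewrite -[n](ins_rest i) -[m](ins_rest j).
  rewrite (permPl (perm_codom_ins _ _ _)) perm_sym (permPl (perm_codom_ins _ _ _)).
  by rewrite ij perm_cons perm_sym.
have -> : (k.+1 ^ 2 * (H * #|@offdiag_solution x H k|) = \sum_(i < k.+1) \sum_(j < k.+1) H * #|@offdiag_solution x H k|)%N.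
  by rewrite !sum_nat_const !card_ord -mulnn -mulnA.
apply: leq_trans (_ : #|@disjoint_solution x H k.+1| + \sum_(i < k.+1) \sum_(j < k.+1) #|S i j| <= _)%N; last first.
  by rewrite leq_add2l; apply: leq_sum => i _; apply: leq_sum => j _.
rewrite -!sum1_card big_mkcond [X in (_ <= X + _)%N]big_mkcond /=.
under [X in (_ <= _ + X)%N]eq_bigr do under eq_bigr do rewrite -sum1_card big_mkcond /=.
under [X in (_ <= _ + X)%N]eq_bigr do rewrite exchange_big /=.
rewrite exchange_big /= -big_split /=; apply: leq_sum => p _.
case: ifP => // po; have ps : solution p by case/andP: po.
case: ifP => [//|]; rewrite /disjoint_solution unfold_in ps /= => /negbT.
rewrite negb_forall => /existsP[i]; rewrite negb_forall => /existsP[j]; rewrite negbK => ij.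
rewrite (bigD1 i) //= (bigD1 j) //= !inE.
  by rewrite ij andbT; move: po; rewrite unfold_in => po; rewrite /offdiag_solution po. 
Qed.

(** The recursion of [card_offdiagonal_rec] after division by [H ^ k]. It starts at 0 since the two
    empty tuples are permutations of each other. *)
Fixpoint offdiag_const (R : pzRingType) (c : nat -> R) k : R :=
  if k is k'.+1 then c k + k%:R ^+ 2 * offdiag_const c k' else 0.

Lemma card_offdiagonal (R : realFieldType) (c : nat -> R) e x H k : 
  (forall j, (0 < j <= k)%N -> #|@disjoint_solution x H j|%:R <= c j * H%:R ^+ j * e) ->
  #|@offdiag_solution x H k|%:R <= offdiag_const c k * H%:R ^+ k * e.
Proof.
elim: k => [|k IH] cD /=.
  rewrite !mul0r eq_card0 // => -[n m]; rewrite !unfold_in.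
  have -> : n = m by apply/ffunP => -[].
  by rewrite perm_refl andbF.
have := card_offdiagonal_rec x H k; rewrite -(ler_nat R) => /le_trans -> //.
rewrite natrD !mulrDl lerD ?cD //= natrM natrX natrM -!mulrA ler_wpM2l ?sqr_ge0 //.
rewrite ler_wpM2l // exprS -mulrA mulrCA ler_wpM2l // mulrA IH // => j jk.
by apply: cD; lia.
Qed.

(** * The divisor bound *)

Lemma tau_primepow B k p v : prime p -> (tau B k (p ^ v) <= v.+1 ^ k)%N.
Proof.
move=> pp; pose P := [pred a : 'I_B | (a %| p ^ v)%N].
have cP : (#|P| <= v.+1)%N.
  rewrite -[leqRHS]card_ord -(card_in_imset (f := fun t : 'I_B => inord (logn p t) : 'I_v.+1)) ?max_card //.
  move=> s t /(dvdn_pfactor _ _ pp)[a av sa] /(dvdn_pfactor _ _ pp)[b bv tb].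
  rewrite sa tb !pfactorK // => /(congr1 val) /=; rewrite !inordK // => ab.
  by apply/val_inj; rewrite /= sa tb ab.
apply: (@leq_trans (#|P| ^ k)); last exact: leq_exp2rW.
have -> : (#|P| ^ k)%N = #|(ffun_on P : {pred {ffun 'I_k -> 'I_B}})| by rewrite card_ffun_on card_ord.
apply: subset_leq_card; apply/subsetP => a; rewrite inE => /eqP aE.
by apply/ffun_onP => i; rewrite inE -aE dvdn_tprod.
Qed.

(** For [s > 0] and [q] the integer quotient of [v] by [s]: [v + 1 <= s * (q + 1)], [q + 1 <= 2 ^ q]
    and [q * s <= v]. *)
Lemma expn_succ_le s v : (v.+1 ^ s <= s.+1 ^ s * 2 ^ v)%N.
Proof.
case: s => [|s]; first by rewrite !expn0 mul1n expn_gt0.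
apply: (@leq_trans ((s.+1 * (v %/ s.+1).+1) ^ s.+1)).
  by apply: leq_exp2rW; rewrite mulnC; have := ltn_ceil v (ltn0Sn s).
rewrite expnMn leq_mul ?leq_exp2rW //.
apply: (@leq_trans ((2 ^ (v %/ s.+1)) ^ s.+1)); first by apply: leq_exp2rW; rewrite ltn_expl.
by rewrite -expnM leq_exp2l // leq_divM.
Qed.

(** The divisor bound tau(n) << n^(1/r), uniform in [B]. With [s = k * r], a prime power contributes
    at most (v + 1)^s, which is at most p^v if p >= 2^s and at most C0 p^v otherwise; at most 2^s
    primes are of the second kind. *)
Lemma tau_pow_le k r : exists C, forall B n, (0 < n)%N -> (tau B k n ^ r <= C * n)%N.
Proof.
pose s := (k * r)%N; pose C0 := (s.+1 ^ s)%N; pose c p := if (p < 2 ^ s)%N then C0 else 1%N.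
have C00 : (0 < C0)%N by rewrite expn_gt0.
exists (C0 ^ (2 ^ s))%N => B n n0.
have nE : n = (\prod_(p <- primes n) p ^ logn p n)%N.
  by rewrite {1}(prod_prime_decomp n0) prime_decompE big_map.
have tau_seq (l : seq nat) (F : nat -> nat) : (forall p, p \in l -> (0 < F p)%N) ->
    (tau B k (\prod_(p <- l) F p) <= \prod_(p <- l) tau B k (F p))%N.
  elim: l => [|p l IH] Fl; first by rewrite !big_nil tau1.
  have Fl' q : q \in l -> (0 < F q)%N by move=> ql; rewrite Fl // inE ql orbT.
  rewrite !big_cons; apply: leq_trans (tau_mul _ _ _ _) _.
  - by rewrite Fl // mem_head.
  - by rewrite big_seq prodn_cond_gt0.
  - by rewrite leq_mul // IH.
have pn p : p \in primes n -> prime p by rewrite mem_primes => /and3P[].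
rewrite {1}nE; apply: (@leq_trans ((\prod_(p <- primes n) tau B k (p ^ logn p n)) ^ r)).
  by apply: leq_exp2rW; apply: tau_seq => p /pn /prime_gt0 p0; rewrite expn_gt0 p0.
rewrite (big_morph (expn^~ r) (fun u v => expnMn u v r) (exp1n r)); apply: (@leq_trans (\prod_(p <- primes n) (c p * p ^ logn p n))).
  rewrite big_seq [leqRHS]big_seq; apply: leq_prod => p /pn pp.
  apply: (@leq_trans ((logn p n).+1 ^ s)).
    by rewrite /s expnM leq_exp2rW // tau_primepow.
  rewrite /c; case: ltnP => [_|ps].
    apply: leq_trans (expn_succ_le _ _) _; rewrite leq_mul // leq_exp2rW //.
    exact: prime_gt1.
  rewrite mul1n; apply: (@leq_trans ((2 ^ logn p n) ^ s)).
    by apply: leq_exp2rW; rewrite ltn_expl.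
  by rewrite -expnM mulnC expnM leq_exp2rW.
rewrite big_split /= -nE leq_mul2r; apply/orP; right.
rewrite /c -big_mkcond big_const_seq iter_muln_1 leq_pexp2l // -size_filter.
rewrite -[leqRHS](size_iota 0); apply: uniq_leq_size; first by rewrite filter_uniq ?primes_uniq.
by move=> p; rewrite mem_filter mem_iota => /andP[].
Qed.

(** * Averages over roots of unity *)

Definition small_prime N := {p : 'I_N.+1 | prime p}.

Definition spval N (p : small_prime N) : nat := val (val p).

(* The completely multiplicative function taking the value w ^ (j p) at p. *)
Definition root_cmul (C : comPzRingType) N M (w : C) (j : {ffun small_prime N -> 'I_M}) n : C :=
  \prod_p w ^+ (j p * logn (spval p) n).

Lemma root_cmul1 (C : comPzRingType) N M (w : C) (j : {ffun small_prime N -> 'I_M}) :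
  root_cmul w j 1 = 1.
Proof. by apply: big1 => p _; rewrite logn1 muln0. Qed.

Lemma root_cmulM (C : comPzRingType) N M (w : C) (j : {ffun small_prime N -> 'I_M}) m n :
  (0 < m)%N -> (0 < n)%N -> root_cmul w j (m * n) = root_cmul w j m * root_cmul w j n.
Proof.
move=> m0 n0; rewrite /root_cmul -big_split; apply: eq_bigr => p _.
by rewrite /= lognM // mulnDr exprD.
Qed.

Lemma root_cmul_prime (C : comPzRingType) N M (w : C) (j : {ffun small_prime N -> 'I_M}) p :
  root_cmul w j (spval p) = w ^+ j p.
Proof.
rewrite /root_cmul (bigD1 p) //= logn_prime ?(valP p) // eqxx muln1 big1 ?mulr1 // => q qp.
rewrite logn_prime; last exact: (valP p).
by rewrite (inj_eq val_inj) (inj_eq val_inj) (negbTE qp) muln0.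
Qed.

Lemma root_cmul_prod (C : comPzRingType) N M (w : C) (j : {ffun small_prime N -> 'I_M})
    k (a : 'I_k -> nat) : (forall i, (0 < a i)%N) ->
  root_cmul w j (\prod_i a i) = \prod_i root_cmul w j (a i).
Proof.
elim: k a => [|k IH] a a0; first by rewrite !big_ord0 root_cmul1.
by rewrite !big_ord_recl root_cmulM ?IH // prodn_gt0.
Qed.

Lemma sum_root_powers (C : idomainType) M (z : C) : z ^+ M = 1 ->
  \sum_(i < M) z ^+ i = if z == 1 then M%:R else 0.
Proof.
move=> zM; case: eqP => [->|/eqP z1].
  by under eq_bigr do rewrite expr1n; rewrite sumr_const card_ord.
apply/eqP; have := subrX1 z M; rewrite zM subrr => /esym/eqP.
by rewrite mulf_eq0 subr_eq0 (negbTE z1).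
Qed.

Lemma prim_root_conj (C : numClosedFieldType) M (w : C) :
  M.-primitive_root w -> w * w^* = 1.
Proof.
move=> wp; have M0 := prim_order_gt0 wp.
rewrite -normCK; suff -> : `|w| = 1 by rewrite expr1n.
by apply/eqP; rewrite -(pexpr_eq1 M0) ?normr_ge0 // -normrX (prim_expr_order wp) normr1.
Qed.

Lemma prim_root_mul_conj (C : numClosedFieldType) M (w : C) u v :
  M.-primitive_root w -> (u < M)%N -> (v < M)%N ->
  (w ^+ u * (w ^+ v)^* == 1) = (u == v).
Proof.
move=> wp; wlog uv : u v / (v <= u)%N => [hw uM vM|uM vM].
  have [/hw->//|/ltnW vu] := leqP v u.
  rewrite [RHS]eq_sym -hw // -(inj_eq (inv_inj conjCK)) rmorphM /= conjCK rmorph1 mulrC //.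
have wv1 : w ^+ v * (w ^+ v)^* = 1.
  by rewrite rmorphXn /= -exprMn (prim_root_conj wp) expr1n.
rewrite -{1}(subnK uv) exprD -mulrA wv1 mulr1 -(prim_order_dvd wp).
have [->|ne] := eqVneq u v; first by rewrite subnn dvdn0.
by rewrite gtnNdvd //; lia.
Qed.

(** The sum factors over primes into geometric sums, which vanish unless the valuations of [U] and
    [V] agree modulo [M]. Valuations are below [M], and all primes dividing [U * V] are seen, so
    agreement everywhere means [U = V]. *)
Lemma root_cmul_orthogonal (C : numClosedFieldType) N M (w : C) U V :
  M.-primitive_root w -> (0 < U)%N -> (0 < V)%N -> (U < M)%N -> (V < M)%N ->
  (forall p, prime p -> (p %| U * V)%N -> (p <= N)%N) ->
  \sum_(j : {ffun small_prime N -> 'I_M}) root_cmul w j U * (root_cmul w j V)^* =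
  (M ^ #|{: small_prime N}|)%:R * (U == V)%:R.
Proof.
move=> wp U0 V0 UM VM UVN.
pose z (p : small_prime N) := w ^+ logn (spval p) U * (w ^+ logn (spval p) V)^*.
have zM p : z p ^+ M = 1.
  rewrite /z exprMn -exprM mulnC exprM (prim_expr_order wp) expr1n mul1r.
  by rewrite -rmorphXn -exprM mulnC exprM (prim_expr_order wp) expr1n rmorph1.
transitivity (\sum_(j : {ffun small_prime N -> 'I_M}) \prod_p z p ^+ j p).
  apply: eq_bigr => j _; rewrite /root_cmul rmorph_prod -big_split /=.
  apply: eq_bigr => p _; rewrite /z exprMn -rmorphXn -!exprM.
  by rewrite mulnC [(j p * _)%N]mulnC.
rewrite -(bigA_distr_bigA (fun p (i : 'I_M) => z p ^+ i)).
under eq_bigr do rewrite (sum_root_powers (zM _)).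
have zE p : (z p == 1) = (logn (spval p) U == logn (spval p) V).
  by apply: (prim_root_mul_conj wp); [apply: leq_ltn_trans UM|apply: leq_ltn_trans VM];
    apply: ltnW; apply: ltn_logl.
have [UV|ne] := eqVneq U V.
  rewrite mulr1 natrX -prodr_const; apply: eq_bigr => p _.
  by rewrite zE UV eqxx.
have [p pne] : exists p, z p != 1.
  apply/existsP; apply: contraNT ne; rewrite negb_exists => /forallP z1.
  apply/eqP/eqn_from_log => // q.
  have [qp|qp] := boolP (prime q); last by rewrite /logn (negbTE qp).
  have [qN|Nq] := leqP q N.
    have := z1 (Sub (Ordinal (qN : q < N.+1)%N) qp); rewrite negbK zE.
    by move=> /eqP.
  have qUV : ~~ (q %| U * V)%N by apply: contraTN Nq => /(UVN _ qp); rewrite leqNgt.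
  move: qUV; rewrite Euclid_dvdM // negb_or => /andP[qU qV].
  by rewrite !logn_coprime ?prime_coprime.
by rewrite mulr0 (bigD1 p) //= (negbTE pne) mul0r.
Qed.

Lemma root_cmul_moment (C : numClosedFieldType) x H k M (w : C) :
  M.-primitive_root w -> ((x + H) ^ k < M)%N ->
  \sum_(j : {ffun small_prime (x + H) -> 'I_M})
    ((\sum_(x.+1 <= n < (x + H).+1) root_cmul w j n)
     * (\sum_(x.+1 <= n < (x + H).+1) root_cmul w j n)^*) ^+ k =
  (M ^ #|{: small_prime (x + H)}|)%:R * #|@solution x H k|%:R.
Proof.
move=> wp kM; set B := (x + H).+1.
pose D := [pred n : 'I_B | (x < n)%N].
have DP (a : {ffun 'I_k -> 'I_B}) : a \in ffun_on D -> [/\ forall i, (0 < a i)%N,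
    (0 < tprod a)%N, (tprod a < M)%N &
    forall p, prime p -> (p %| tprod a)%N -> (p <= x + H)%N].
  move=> /ffun_onP aD.
  have a0 i : (0 < a i)%N by apply: leq_ltn_trans (aD i).
  split => //; first by rewrite /tprod prodn_gt0.
    apply: leq_ltn_trans kM; apply: tprod_le_exp => i; rewrite -ltnS; exact: ltn_ord.
  move=> p pp; rewrite /tprod; elim/big_ind: _ => [|u v hu hv|i _].
  - by rewrite dvdn1 => /eqP p1; rewrite p1 in pp.
  - by rewrite Euclid_dvdM // => /orP[/hu|/hv].
  - by move=> /(dvdn_leq (a0 i)) /leq_trans; apply; rewrite -ltnS; exact: ltn_ord.
have powE (g : nat -> C) : (\sum_(x.+1 <= n < B) g n) ^+ k =
    \sum_(a : {ffun 'I_k -> 'I_B} | a \in ffun_on D) \prod_i g (a i).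
  rewrite (big_geq_mkord _ _ xpredT) /= -[k in LHS]card_ord -prodr_const.
  rewrite (bigA_distr_big D (fun _ (n : 'I_B) => g n)).
  by [].
transitivity (\sum_(j : {ffun small_prime (x + H) -> 'I_M})
  \sum_(a : {ffun 'I_k -> 'I_B} | a \in ffun_on D) \sum_(b : {ffun 'I_k -> 'I_B} | b \in ffun_on D)
    root_cmul w j (tprod a) * (root_cmul w j (tprod b))^*).
  apply: eq_bigr => j _; rewrite exprMn -rmorphXn powE rmorph_sum big_distrlr /=.
  apply: eq_bigr => a /DP[a0 _ _ _]; apply: eq_bigr => b /DP[b0 _ _ _].
  by rewrite /tprod !root_cmul_prod.
rewrite exchange_big /=; under eq_bigr do rewrite exchange_big /=.
transitivity (\sum_(a : {ffun 'I_k -> 'I_B} | a \in ffun_on D)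
  \sum_(b : {ffun 'I_k -> 'I_B} | b \in ffun_on D)
  (M ^ #|{: small_prime (x + H)}|)%:R * (tprod a == tprod b)%:R : C).
  apply: eq_bigr => a /DP[_ a0 aM ap]; apply: eq_bigr => b /DP[_ b0 bM bp].
  apply: root_cmul_orthogonal => // p pp.
  by rewrite Euclid_dvdM // => /orP[/(ap _ pp)|/(bp _ pp)].
under eq_bigr do rewrite -mulr_sumr.
rewrite -mulr_sumr; congr (_ * _); rewrite pair_big /= natr_card.
rewrite [RHS]big_mkcond /= big_mkcond; apply: eq_bigr => -[a b] _ /=.
rewrite /solution /=.
have -> : (a \in ffun_on D) = [forall i, (x < a i)%N] by [].
have -> : (b \in ffun_on D) = [forall i, (x < b i)%N] by [].
by rewrite andbA; case: (_ && _) => //=; case: (_ == _).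
Qed.

(* The analysis library is loaded only here because it shadows several names
   (subsetP, imageP, permP) of the finite combinatorics used above. *)
From mathcomp Require Import all_classical all_reals all_analysis.
From mathcomp Require Import measurable_realfun complex.

Import numFieldNormedType.Exports.

Local Open Scope classical_set_scope.
Local Open Scope ring_scope.

(** * The asymptotic count *)

(** Induction, from 1/m <= ln m - ln (m - 1), which is ln (1 + t) <= t at t = -1/m. *)
Lemma harm_le (R : realType) n : (0 < n)%N -> harm R n.+1 <= 1 + ln n%:R.
Proof.
case: n => // n _; elim: n => [|n IH].
  by rewrite /harm !big_ord_recr big_ord0 /= invr0 invr1 ln1 !addr0 add0r.
rewrite /harm big_ord_recr /= -/(harm R n.+2).
apply: le_trans (lerD IH (lexx _)) _; rewrite -addrA lerD2l -lerBrDl.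
have n20 : 0 < n.+2%:R :> R by rewrite ltr0n.
have n10 : 0 < n.+1%:R :> R by rewrite ltr0n.
have := @le_ln1Dx R (- n.+2%:R^-1).
have -> : 1 + - n.+2%:R^-1 = n.+1%:R / n.+2%:R :> R.
  by rewrite -(natr1 n.+1); field; rewrite gt_eqF // addr_gt0.
rewrite lnM ?posrE ?invr_gt0 // lnV ?posrE // ltrN2 => /(_ _); rewrite invf_lt1 // ltr1n => /(_ isT).
by rewrite -lerN2 opprB.
Qed.

(** From [x + H <= 2 * x * H] and [ln 2 <= 1]. *)
Lemma harm_log (R : realType) x H : (0 < x)%N -> (0 < H)%N ->
  harm R (x + H).+1 <= 2 + (ln x%:R + ln H%:R).
Proof.
move=> x0 H0; apply: le_trans (harm_le _ _) _; first by rewrite addn_gt0 x0.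
have xp : 0 < x%:R :> R by rewrite ltr0n.
have Hp : 0 < H%:R :> R by rewrite ltr0n.
have h : ln (x + H)%:R <= ln (2 * x%:R * H%:R) :> R.
  rewrite ler_ln ?posrE ?mulr_gt0 ?ltr0n ?addn_gt0 ?x0 //.
  by rewrite -!natrM ler_nat; nia.
apply: le_trans (lerD (lexx 1) h) _.
rewrite !lnM ?posrE ?mulr_gt0 ?ltr0n //.
have := @ln_sublinear R 2 (ltr0n _ _); have := @le_ln1Dx R 1.
have -> : 1 + 1 = 2 :> R by rewrite -natr1.
by move=> /(_ _); rewrite (@lt_trans _ _ 0) ?ltrN10 // => /(_ isT); lra.
Qed.

(** [2 + L] is at most 3 or at most 3L. The summand 1 is there because [L = 0] when [x = H = 1]. *)
Lemma log_pow_le (R : realType) (L : R) j E : 0 <= L -> (j <= E)%N ->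
  (2 + L) ^+ j <= 3 ^+ E * (1 + L ^+ E).
Proof.
move=> L0 jE; apply: (@le_trans _ _ ((2 + L) ^+ E)).
  by rewrite ler_weXn2l //; lra.
have [L1|L1] := leP L 1.
  apply: (@le_trans _ _ (3 ^+ E)); first by apply: lerXn2r; rewrite ?nnegrE; lra.
  by rewrite ler_peMr ?exprn_ge0 // lerDl exprn_ge0.
apply: (@le_trans _ _ (3 ^+ E * L ^+ E)).
  by rewrite -exprMn; apply: lerXn2r; rewrite ?nnegrE; lra.
by rewrite ler_wpM2l ?exprn_ge0 // lerDr.
Qed.

(** Half of the saving H / x, a factor sqrt(H / x), is spent on absorbing the divisor functions. *)
Lemma incidence_pointwise (R : realType) K : exists2 c : R, 0 <= c &
  forall x H, (0 < x)%N -> (0 < H <= x)%N ->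
    (H ^ (2 * K.+1) <= x ^ (2 * K.+1).-1)%N ->
    (incidence x H (x + H).+1 K)%:R <=
      c * H%:R ^+ K.+1 * Num.sqrt (H%:R / x%:R) :> R.
Proof.
(* With this [r], the [4 * K.+1]-th power of Y^(K+2) sqrt(H / x) is Y^r (H / x)^(2(K+1)), bounded
   because Y^r << x and the other factor is at most 1/x. *)
pose r := (K.+2 * (4 * K.+1))%N.
have [C1 hC1] := tau_pow_le K r; have [C2 hC2] := tau_pow_le K.+1 r.
pose C := (2 * maxn C1 C2)%N.
exists (3 ^+ K.+1 * C.+1%:R); first by rewrite mulr_ge0 ?exprn_ge0.
move=> x H x0 /andP[H0 Hx] xH; set B := (x + H).+1.
pose Y := (\max_(n < B | 0 < n) maxn (tau B K n) (tau B K.+1 n))%N.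
have Yn n : (0 < n <= x + H)%N -> (maxn (tau B K n) (tau B K.+1 n) <= Y)%N.
  move=> /andP[n0 nB]; have nB' : (n < B)%N by [].
  exact: (leq_bigmax_cond (Ordinal nB')).
have Yr : (Y ^ r <= C * x)%N.
  rewrite /Y; elim/big_ind: _ => [|u v hu hv|n n0]; first by rewrite exp0n.
    by rewrite /maxn; case: ifP.
  have nx : (n <= 2 * x)%N by have := ltn_ord n; rewrite /B ltnS; lia.
  have mx : (maxn C1 C2 * n <= C * x)%N by rewrite /C mulnAC [leqRHS]mulnC leq_mul2l nx orbT.
  rewrite {1}/maxn; case: ifP => _.
    by apply: leq_trans mx; apply: leq_trans (hC2 _ _ n0) _; rewrite leq_mul2r leq_maxr orbT.
  by apply: leq_trans mx; apply: leq_trans (hC1 _ _ n0) _; rewrite leq_mul2r leq_maxl orbT.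
have xp : 0 < x%:R :> R by rewrite ltr0n.
have q0 : 0 <= H%:R / x%:R :> R by rewrite divr_ge0.
apply: le_trans (@incidence_short R x H K Y x0 _ _) _.
- by move=> n /Yn; rewrite geq_max => /andP[].
- by move=> n /Yn; rewrite geq_max => /andP[].
rewrite -[in leLHS](sqr_sqrtr q0) expr2; set s := Num.sqrt _.
have s0 : 0 <= s by exact: sqrtr_ge0.
suff Ys : Y%:R ^+ K.+2 * s <= C.+1%:R.
  have := ler_wpM2l (_ : 0 <= 3 ^+ K.+1 * H%:R ^+ K.+1 * s) Ys.
  rewrite !mulr_ge0 ?exprn_ge0 // => /(_ isT); congr (_ <= _); ring.
have v0 : 0 <= Y%:R ^+ K.+2 * s by rewrite mulr_ge0 ?exprn_ge0.
have vm : (Y%:R ^+ K.+2 * s) ^+ (4 * K.+1) <= C%:R.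
  rewrite exprMn -exprM -/r (_ : 4 * K.+1 = 2 * (2 * K.+1))%N; last by rewrite mulnA.
  rewrite [s ^+ _]exprM /s sqr_sqrtr // expr_div_n mulrA ler_pdivrMr ?exprn_gt0 //.
  rewrite -!natrX -!natrM ler_nat; apply: leq_trans (leq_mul Yr xH) _.
  by rewrite -mulnA -expnS prednK // muln_gt0.
rewrite leNgt; apply/negP => lt.
have : C.+1%:R ^+ (4 * K.+1) <= (Y%:R ^+ K.+2 * s) ^+ (4 * K.+1).
  by apply: lerXn2r; rewrite ?nnegrE // ltW.
move=> /le_trans/(_ vm); rewrite leNgt => /negP; apply.
apply: (@lt_le_trans _ _ (C.+1%:R)); first by rewrite ltr_nat.
by rewrite ler_eXnr // ler1n.
Qed.

Lemma disjoint_solution_bound (R : realType) k : (0 < k)%N -> exists2 c : R, 0 <= c &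
  forall x H, (0 < x)%N -> (0 < H <= x)%N ->
    #|@disjoint_solution x H k|%:R <= c * H%:R ^+ k * (Num.sqrt (H%:R / x%:R)
      + H%:R / x%:R * (2 + (ln x%:R + ln H%:R)) ^+ Eexp k) :> R.
Proof.
case: k => [//|[|K] _].
(* For [k = 1] the equation reads n = m, so nothing is disjoint. *)
- exists 0 => // x H x0 H0; rewrite eq_card0 ?mul0r // => -[n m].
  apply/negP => /andP[/and3P[/= _ _ /eqP nm]] /'forall_forallP/(_ ord0 ord0) /=.
  by apply/negP; rewrite negbK; apply/eqP/val_inj; move: nm; rewrite /tprod !big_ord1.
have [c c0 hc] := incidence_pointwise R K.+1.
pose c' : R := 12 * K.+2%:R * (3 * K.+1)%:R ^+ K.+1.
have c'0 : 0 <= c' by rewrite !mulr_ge0 ?exprn_ge0.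
exists (c + c'); first by rewrite addr_ge0.
move=> x H x0 /[dup] H0x /andP[H0 Hx].
have q0 : 0 <= H%:R / x%:R :> R by rewrite divr_ge0.
have L0 : 0 <= ln x%:R + ln H%:R :> R by rewrite addr_ge0 // ln_ge0 // ler1n.
have T0 : 0 <= H%:R / x%:R * (2 + (ln x%:R + ln H%:R)) ^+ Eexp K.+2 :> R.
  by rewrite mulr_ge0 // exprn_ge0 // addr_ge0.
have S0 : 0 <= Num.sqrt (H%:R / x%:R) :> R by exact: sqrtr_ge0.
have P0 : 0 <= H%:R ^+ K.+2 :> R by rewrite exprn_ge0.
have := card_disjoint_solution x H K.+1; rewrite -(ler_nat R) => /le_trans; apply.
have [xH|/ltnW xH] := leqP (x ^ (2 * K.+2).-1) (H ^ (2 * K.+2)); last first.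
  apply: le_trans (hc x H x0 H0x xH) _.
  by apply: ler_pM => //; [exact: mulr_ge0|apply: ler_wpM2r|]; rewrite ?lerDl.
apply: le_trans (incidence_long R x0 Hx xH) _.
rewrite -/c' -[c' * _ * _ * _]mulrA; apply: ler_pM.
- exact: mulr_ge0.
- by apply: mulr_ge0 => //; rewrite exprn_ge0 // harm_ge0.
- by apply: ler_wpM2r => //; rewrite lerDr.
rewrite -[leLHS]add0r; apply: lerD => //; apply: ler_wpM2l => //.
apply: (@le_trans _ _ ((2 + (ln x%:R + ln H%:R)) ^+ (K * K.+1 + K.+1 * K.+1))).
  by apply: lerXn2r; [exact: harm_ge0|exact: addr_ge0|exact: harm_log].
(* The exponent reached is (k - 1)(2k - 3), below 2k^2 + 2. *)
by apply: ler_weXn2l; [lra|rewrite /Eexp; nia].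
Qed.


Lemma solution_split x H k :
  (#|@solution x H k| = #|@diag_solution x H k| + #|@offdiag_solution x H k|)%N.
Proof.
rewrite -!sum1_card (bigID (fun p : {ffun 'I_k -> 'I_(x + H).+1} * {ffun 'I_k -> 'I_(x + H).+1} =>
  perm_eq (codom p.1) (codom p.2))) /=.
by congr (_ + _)%N; apply: eq_bigl => p; rewrite !unfold_in.
Qed.

Lemma diagonal_error (R : realType) x H k : (0 < H)%N -> (0 < k)%N ->
  `|#|@diag_solution x H k|%:R / H%:R ^+ k - k`!%:R| <= (k`! * k ^ 2)%:R * H%:R^-1 :> R.
Proof.
move=> H0 k0; have [h1 h2] := card_diagonal x H k.
have Hp : 0 < H%:R ^+ k :> R by rewrite exprn_gt0 ?ltr0n.
have -> : (k`! * k ^ 2)%:R * H%:R^-1 = (k`! * k ^ 2)%:R * H%:R ^+ k.-1 / H%:R ^+ k :> R.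
  rewrite -mulrA; congr (_ * _); rewrite -{2}(prednK k0) exprS; field.
  by rewrite -natrX pnatr_eq0 -?lt0n ?expn_gt0 ?H0 // pnatr_eq0 -lt0n H0.
have -> : #|@diag_solution x H k|%:R / H%:R ^+ k - k`!%:R
    = (#|@diag_solution x H k|%:R - k`!%:R * H%:R ^+ k) / H%:R ^+ k :> R.
  by rewrite mulrBl mulfK // gt_eqF.
rewrite normrM [ `|_^-1| ]gtr0_norm ?invr_gt0 // ler_wpM2r ?invr_ge0 ?(ltW Hp) //.
rewrite -!natrX -!natrM distrC ger0_norm ?subr_ge0 ?ler_nat // lerBlDl -natrD ler_nat.
by rewrite -mulnA.
Qed.

Lemma sqr_le_Eexp k : (k * k <= Eexp k)%N.
Proof. by rewrite /Eexp mulnn (leq_trans _ (leq_addr _ _)) // leq_pmull. Qed.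

(** For H <= x the diagonal gives k! + O(1/H) and the off-diagonal solutions give the other two
    error terms. For H > x the error term is at least 1 plus a power of the logarithm, and the crude
    bound on all solutions suffices. *)
Lemma solution_count (R : realType) k : (0 < k)%N -> exists C : R, 0 < C /\
  forall x H, (0 < x)%N -> (0 < H)%N ->
    `|#|@solution x H k|%:R / H%:R ^+ k - k`!%:R| <= C * error_term R x H k.
Proof.
move=> k0.
have /choice[c hc] (j : nat) : exists c : R, (0 < j)%N -> 0 <= c /\
  forall x H, (0 < x)%N -> (0 < H <= x)%N ->
    #|@disjoint_solution x H j|%:R <= c * H%:R ^+ j * (Num.sqrt (H%:R / x%:R)
      + H%:R / x%:R * (2 + (ln x%:R + ln H%:R)) ^+ Eexp j) :> R.
  case: j => [|j]; first by exists 0.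
  by have [c c0 hc] := @disjoint_solution_bound R j.+1 isT; exists c.
pose q := offdiag_const c k.
have q0 : 0 <= q.
  rewrite /q; elim: (k) => //= j IH.
  by rewrite addr_ge0 ?mulr_ge0 ?exprn_ge0 //; case: (hc j.+1 isT).
pose D : R := (k`! * k ^ 2)%:R; have D0 : 0 <= D by rewrite ler0n.
pose W : R := 3 ^+ Eexp k; have W1 : 1 <= W by rewrite exprn_ege1 // ler1n.
pose V : R := 2 ^+ k * W; have V0 : 0 <= V by rewrite mulr_ge0 ?exprn_ge0.
have k1 : 1 <= k`!%:R :> R by rewrite ler1n fact_gt0.
have W0 : 0 <= W by apply: le_trans W1.
have qW : 0 <= q * (1 + W) by rewrite mulr_ge0 // addr_ge0.
(* [D] serves the diagonal and [q * (1 + W)] the off-diagonal part; [V] and the factorial serve the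
   range H > x. *)
pose C := D + q * (1 + W) + V + k`!%:R.
exists C; split; first by rewrite /C; lra.
move=> x H x0 H0.
have xp : 0 < x%:R :> R by rewrite ltr0n.
have Hp : 0 < H%:R :> R by rewrite ltr0n.
pose L : R := ln x%:R + ln H%:R.
have L0 : 0 <= L by rewrite addr_ge0 // ln_ge0 // ler1n.
have LE0 : 0 <= L ^+ Eexp k by rewrite exprn_ge0.
have Hk0 : 0 < H%:R ^+ k :> R by rewrite exprn_gt0.
rewrite /error_term -/L.
have [Hx|xH] := leqP H x.
  rewrite -sqrtrV ?ler0n // -sqrtrM ?ler0n //.
  rewrite [H%:R * _ / _]mulrAC.
  set u := H%:R / x%:R; set s := Num.sqrt u.
  have u0 : 0 <= u by rewrite divr_ge0.
  have u1 : u <= 1 by rewrite ler_pdivrMr // mul1r ler_nat.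
  have s0 : 0 <= s by exact: sqrtr_ge0.
  (* The constant part of the bound on the power of [2 + L] leaves a multiple of [u], absorbed by
     the square root. *)
  have us : u <= s.
    have s1 : s <= 1 by rewrite -sqrtr1 ler_wsqrtr.
    by rewrite -[u]sqr_sqrtr // expr2 -/s ler_piMl.
  have ho : #|@offdiag_solution x H k|%:R <= q * H%:R ^+ k * (s + u * (2 + L) ^+ Eexp k).
    apply: card_offdiagonal => j /andP[j0 jk]; have [cj hj] := hc j j0.
    apply: le_trans (hj x H x0 _) _; first by rewrite H0.
    rewrite ler_wpM2l ?mulr_ge0 ?exprn_ge0 // lerD2l ler_wpM2l //.
    apply: ler_weXn2l; first by rewrite -/L; lra.
    by rewrite /Eexp leq_add2r leq_mul2l leq_exp2r.
  have hL := log_pow_le L0 (leqnn (Eexp k)); rewrite -/W in hL.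
  rewrite solution_split natrD mulrDl addrAC.
  apply: le_trans (ler_normD _ _) _.
  have hd := @diagonal_error R x H k H0 k0; rewrite -/D in hd.
  have ho' : `|#|@offdiag_solution x H k|%:R / H%:R ^+ k| <= q * ((1 + W) * s + W * (u * L ^+ Eexp k)).
    rewrite ger0_norm ?divr_ge0 // ?(ltW Hk0) // ler_pdivrMr // mulrAC.
    apply: le_trans ho _; apply: ler_wpM2l; first by rewrite mulr_ge0 // ltW.
    have := ler_wpM2l u0 hL; have := ler_wpM2l W0 us; clear; move: (u * _) => v.
    by rewrite mulrDr mulr1 mulrDr [u * (W * _)]mulrCA [u * W]mulrC; lra.
  apply: le_trans (lerD hd ho') _.
  have t0 : 0 <= u * L ^+ Eexp k by rewrite mulr_ge0.
  have iH : 0 <= H%:R^-1 :> R by rewrite invr_ge0.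
  have qW' : 0 <= q * W by rewrite mulr_ge0.
  have qE : q * (1 + W) = q + q * W by rewrite mulrDr mulr1.
  have e1 : D * H%:R^-1 <= C * H%:R^-1 by rewrite ler_wpM2r // /C; lra.
  have e2 : q * (1 + W) * s <= C * s by rewrite ler_wpM2r // /C; lra.
  have e3 : q * W * (u * L ^+ Eexp k) <= C * (u * L ^+ Eexp k).
    by rewrite ler_wpM2r // /C; lra.
  move: (u * L ^+ _) (H%:R^-1) e1 e2 e3 => t i e1 e2 e3.
  rewrite (_ : q * _ = q * (1 + W) * s + q * W * t); last by ring.
  rewrite [leRHS](_ : _ = C * i + C * s + C * t); last by ring.
  by rewrite addrA !lerD.
have Hn0 : H%:R != 0 :> R by rewrite gt_eqF.
rewrite mulfV ?sqrtr_eq0 -?ltNge // mulrAC mulfV // mul1r.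
apply: le_trans (ler_normB _ _) _.
have hs : #|@solution x H k|%:R / H%:R ^+ k <= 2 ^+ k * W * (1 + L ^+ Eexp k).
  rewrite ler_pdivrMr //; apply: le_trans (card_solution_le R x H k) _.
  rewrite exprMn -exprM.
  apply: (@le_trans _ _ ((2 * H%:R) ^+ k * (2 + L) ^+ (k * k))).
    apply: ler_pM; rewrite ?exprn_ge0 ?harm_ge0 //.
      by apply: lerXn2r; rewrite ?nnegrE // -natrM ler_nat mul2n -addnn leq_add2r ltnW.
    by apply: lerXn2r; [exact: harm_ge0|exact: addr_ge0|exact: harm_log].
  rewrite exprMn -!mulrA ler_wpM2l ?exprn_ge0 // mulrC mulrA ler_wpM2r ?exprn_ge0 //.
  by apply: log_pow_le => //; exact: sqr_le_Eexp.
rewrite !ger0_norm ?divr_ge0 ?ler0n ?exprn_ge0 //.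
have iH : 0 <= H%:R^-1 :> R by rewrite invr_ge0.
apply: (@le_trans _ _ (C * (1 + L ^+ Eexp k))).
  apply: le_trans (lerD hs (lexx _)) _; rewrite -/V /C.
  have := mulr_ge0 D0 LE0; have := mulr_ge0 qW LE0.
  have : 0 <= k`!%:R * L ^+ Eexp k :> R by rewrite mulr_ge0.
  by rewrite mulrDr mulrDr; move: D0 qW; clear; nra.
by rewrite ler_wpM2l // ?/C; lra.
Qed.

(** * Arcs of the unit circle *)

(** On the unit circle, the argument in [0, 2 pi). *)
Definition angle (R : realType) (z : R * R) : R :=
  if 0 <= z.2 then acos z.1 else 2 * pi - acos z.1.

(* acos is meaningful on [-1, 1] only. *)
Definition circle_arc (R : realType) M i : set (R * R) :=
  [set z | -1 <= z.1 <= 1 /\ i%:R <= angle z * M%:R / pi < i.+1%:R].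

Lemma ler_acos (R : realType) (u v : R) :
  -1 <= u <= 1 -> -1 <= v <= 1 -> u <= v -> acos v <= acos u.
Proof.
move=> hu hv uv; have [/andP[? ?] cu] := acos_def hu; have [/andP[? ?] cv] := acos_def hv.
rewrite leNgt -ltr_cos ?in_itv /= ?cu ?cv -?leNgt //; apply/andP; split => //.
Qed.

(** The composite of [g] with [acos] is monotone on [-1, 1], so the set is an interval. *)
Lemma measurable_acos_itv (R : realType) (g : R -> R) (a b : R) :
  {homo g : u v / u <= v} \/ {homo g : u v / u <= v >-> v <= u} ->
  measurable [set u | -1 <= u <= 1 /\ a <= g (acos u) < b].
Proof.
move=> gm; suff /is_intervalP -> : is_interval [set u | -1 <= u <= 1 /\ a <= g (acos u) < b] by exact: measurable_itv.
move=> u v [/andP[u1 u2] /andP[ua ub]] [/andP[v1 v2] /andP[va vb]].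
move=> w /andP[uw wv]; have w1 : -1 <= w <= 1 by rewrite (le_trans u1 uw) (le_trans wv v2).
split => //.
have hu := @ler_acos R u w _ w1 uw; have hv := @ler_acos R w v w1 _ wv.
rewrite u1 u2 in hu; rewrite v1 v2 in hv.
by case: gm => gm; have gu := gm _ _ (hu isT); have gv := gm _ _ (hv isT); apply/andP; split;
  first [exact: le_trans gu|exact: le_trans gv|exact: le_lt_trans gu ub|exact: le_lt_trans gv vb
        |exact: le_lt_trans _ ub|exact: le_lt_trans _ vb].
Qed.

Lemma measurable_arc (R : realType) M i : measurable (@circle_arc R M i).
Proof.
pose g1 (t : R) : R := t * M%:R / pi.
pose g2 (t : R) : R := (2 * pi - t) * M%:R / pi.
have ip : 0 <= pi^-1 :> R by rewrite invr_ge0 pi_ge0.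
have -> : @circle_arc R M i =
  ([set u | -1 <= u <= 1 /\ i%:R <= g1 (acos u) < i.+1%:R] `*` [set v | 0 <= v]) `|`
  ([set u | -1 <= u <= 1 /\ i%:R <= g2 (acos u) < i.+1%:R] `*` [set v | v < 0]).
  apply/seteqP; split => -[u v]; rewrite /circle_arc /angle /=.
    by case: (leP 0 v) => v0 [h1 h2]; [left|right]; split.
  by case=> -[[h1 h2]]; [move=> ->|rewrite ltNge => /negbTE ->].
apply: measurableU; apply: measurableX.
- by apply: measurable_acos_itv; left => u v uv; rewrite /g1 ler_wpM2r // ler_wpM2r.
- by rewrite (_ : [set v | _] = [set` `[0, +oo[]) //; apply/seteqP; split => v /=; rewrite in_itv /= andbT.
- by apply: measurable_acos_itv; right => u v uv; rewrite /g2 ler_wpM2r // ler_wpM2r // lerB.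
- by rewrite (_ : [set v | _] = [set` `]-oo, 0[]) //; apply/seteqP; split => v /=; rewrite in_itv /=.
Qed.

Lemma arc_disjoint (R : realType) M i j (z : R * R) : circle_arc M i z -> circle_arc M j z -> i = j.
Proof.
move=> [_ /andP[i1 i2]] [_ /andP[j1 j2]].
have := le_lt_trans i1 j2; have := le_lt_trans j1 i2.
by rewrite !ltr_nat !ltnS => ji ij; apply/eqP; rewrite eqn_leq ij ji.
Qed.

Lemma unit_bounds (R : realType) (u v : R) : u ^+ 2 + v ^+ 2 = 1 -> -1 <= u <= 1.
Proof. by move=> h; apply/andP; split; nra. Qed.

Lemma angleP (R : realType) (z : R * R) : z.1 ^+ 2 + z.2 ^+ 2 = 1 ->
  [/\ 0 <= angle z < 2 * pi, cos (angle z) = z.1 & sin (angle z) = z.2].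
Proof.
case: z => u v /= uv; have u1 := unit_bounds uv.
have [/andP[a0 api] cu] := acos_def u1; have := sin_acos u1.
have -> : 1 - u ^+ 2 = v ^+ 2 by rewrite -uv addrC addKr.
rewrite sqrtr_sqr => su; have pp := pi_gt0 R.
rewrite /angle /=; case: ifP => [v0|/negbT].
  by rewrite cu su ger0_norm //; split => //; rewrite a0 /=; lra.
rewrite -ltNge => v0.
have ua : 0 < acos u.
  by apply: acos_gt0; case/andP: u1 => -> u1; rewrite lt_neqAle u1 andbT; apply/eqP => u1'; nra.
have e : 2 * pi - acos u = - acos u + pi *+ 2 by rewrite mulr2n; lra.
by rewrite {3 4}e cosD2pi sinD2pi cosN sinN cu su ltr0_norm // opprK; split => //; apply/andP; split; lra.
Qed.

Lemma angleK (R : realType) (t : R) : 0 <= t < 2 * pi -> angle (cos t, sin t) = t.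
Proof.
move=> /andP[t0 t2]; rewrite /angle /=; have pp := pi_gt0 R.
have [tp|tp] := leP t pi.
  by rewrite sin_ge0_pi ?t0 // cosK // in_itv /= t0.
have e : t = - (2 * pi - t) + pi *+ 2 by rewrite mulr2n; lra.
have s : 0 < sin (2 * pi - t) by apply: sin_gt0_pi; apply/andP; split; lra.
rewrite {1 2 3}e sinD2pi cosD2pi sinN cosN oppr_ge0 leNgt s /= cosK; first lra.
by rewrite in_itv /=; apply/andP; split; lra.
Qed.

Lemma arc_cover (R : realType) M (z : R * R) : (0 < M)%N -> z.1 ^+ 2 + z.2 ^+ 2 = 1 ->
  exists i : 'I_(2 * M), circle_arc M i z.
Proof.
move=> M0 uz; have [/andP[a0 a2] _ _] := angleP uz; have pp := pi_gt0 R.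
have Mp : 0 < M%:R :> R by rewrite ltr0n.
have t0 : 0 <= angle z * M%:R / pi by rewrite divr_ge0 ?pi_ge0 // mulr_ge0.
have /andP[h1 h2] := truncn_itv t0.
have lt : (Num.truncn (angle z * M%:R / pi) < 2 * M)%N.
  rewrite -(ltr_nat R); apply: le_lt_trans h1 _.
  by rewrite ltr_pdivrMr // natrM mulrAC ltr_pM2r.
by exists (Ordinal lt); split; [exact: unit_bounds uz|rewrite h1 h2].
Qed.

Lemma cos_lipschitz (R : realType) (a b : R) : a <= b -> `|cos b - cos a| <= b - a.
Proof.
rewrite le_eqVlt => /predU1P[->|ab]; first by rewrite !subrr normr0.
have [|c _ ->] := @MVT R cos (fun t => - sin t) a b ab (fun x _ => is_derive_cos x).
  exact/continuous_subspaceT/continuous_cos.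
rewrite normrM normrN [ `|b - a| ]ger0_norm ?subr_ge0 ?(ltW ab) //.
by rewrite ler_piMl ?subr_ge0 ?(ltW ab) // ler_norml sin_geN1 sin_le1.
Qed.

Lemma sin_lipschitz (R : realType) (a b : R) : a <= b -> `|sin b - sin a| <= b - a.
Proof.
move=> ab; rewrite -(cosBpihalf b) -(cosBpihalf a).
by apply: le_trans (cos_lipschitz _) _; lra.
Qed.

Lemma arc_close (R : realType) M i (z : R * R) : (0 < M)%N -> z.1 ^+ 2 + z.2 ^+ 2 = 1 ->
  circle_arc M i z ->
  `|z.1 - cos (i%:R * (pi / M%:R))| <= pi / M%:R /\
  `|z.2 - sin (i%:R * (pi / M%:R))| <= pi / M%:R.
Proof.
move=> M0 uz [_ /andP[h1 h2]]; have [_ <- <-] := angleP uz; have pp := pi_gt0 R.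
have Mp : 0 < M%:R :> R by rewrite ltr0n.
have e : angle z = angle z * M%:R / pi * (pi / M%:R) by rewrite mulrA divfK ?mulfK // gt_eqF.
have pM : 0 < pi / M%:R :> R by rewrite divr_gt0.
have l1 : i%:R * (pi / M%:R) <= angle z by rewrite e ler_wpM2r // ltW.
have l2 : angle z - i%:R * (pi / M%:R) <= pi / M%:R.
  rewrite lerBlDr {1}e [leRHS](_ : _ = i.+1%:R * (pi / M%:R)); first by rewrite ler_wpM2r ?ltW.
  by move: (pi / M%:R) => q; rewrite -natr1 mulrDl mul1r addrC.
by split; [apply: le_trans (cos_lipschitz l1) l2|apply: le_trans (sin_lipschitz l1) l2].
Qed.

(** The open interval from i/(2M) to (i+1)/(2M) maps into the arc. An inequality is enough, since
    the masses of the [2 * M] arcs add up to 1 in [steinhaus_arc]. *)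
Lemma lebesgue_arc_ge (R : realType) M i : (0 < M)%N -> (i < 2 * M)%N ->
  (((2 * M)%:R^-1)%:E <= lebesgue_measure
     [set t : R | (0 <= t <= 1)%R /\ circle_arc M i (cos (2 * pi * t)%R, sin (2 * pi * t)%R)])%E.
Proof.
move=> M0 iM; have pp := pi_gt0 R; set S := [set t | _].
have Mp : 0 < (2 * M)%:R :> R by rewrite ltr0n muln_gt0.
have cm (g : R -> R) : continuous g -> measurable_fun setT (fun t : R => g (2 * pi * t)).
  move=> cg; apply: continuous_measurable_fun => t.
  apply: (@continuous_comp _ _ _ (fun t : R => 2 * pi * t) g); last exact: cg.
  by apply: cvgM; [exact: cvg_cst|exact: cvg_id].
have mS : measurable S.
  have -> : S = [set` `[0, 1]%R] `&`
      ((fun t : R => (cos (2 * pi * t), sin (2 * pi * t))) @^-1` (circle_arc M i)).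
    by apply/seteqP; split => t /=; rewrite in_itv.
  have mp : measurable_fun setT (fun t : R => (cos (2 * pi * t), sin (2 * pi * t))).
    apply: measurable_fun_pair; [apply: (cm cos)|apply: (cm sin)].
      exact: continuous_cos.
    exact: continuous_sin.
  apply: measurableI; first exact: measurable_itv.
  by rewrite -[X in measurable X]setTI; apply: mp => //; exact: measurable_arc.
have <- : lebesgue_measure [set` `]i%:R / (2 * M)%:R, i.+1%:R / (2 * M)%:R[] = ((2 * M)%:R^-1)%:E :> \bar R.
  rewrite lebesgue_measure_itv /= lte_fin ltr_pM2r ?invr_gt0 // ltr_nat ltnSn.
  by rewrite -EFinB -mulrBl -natr1 addrAC subrr add0r mul1r.
apply: le_measure; rewrite ?inE //.
move=> t /=; rewrite in_itv /= => /andP[t1 t2].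
have t0 : 0 <= t by apply: le_trans (ltW t1); rewrite divr_ge0.
have t3 : t < 1 by apply: lt_le_trans t2 _; rewrite ler_pdivrMr // mul1r ler_nat.
split; first by rewrite t0 ltW.
split => /=; first by rewrite cos_geN1 cos_le1.
rewrite angleK; last by move: (pi : R) pp => q qp; apply/andP; split; nra.
have -> : 2 * pi * t * M%:R / pi = t * (2 * M)%:R.
  by move: (pi : R) pp => q qp; rewrite natrM; field; rewrite gt_eqF.
by rewrite -ler_pdivrMr // -ltr_pdivlMr // (ltW t1) t2.
Qed.

(** * Discretization of the random function *)

(* No measurability is needed: the integral of a nonnegative function is a
   supremum over the simple functions below it. *)
Lemma ge0_le_integralT (R : realType) d (T : measurableType d)
    (mu : {measure set T -> \bar R}) (f g : T -> \bar R) :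
  (forall w, 0 <= f w)%E -> (forall w, f w <= g w)%E ->
  (\int[mu]_w f w <= \int[mu]_w g w)%E.
Proof.
move=> f0 fg; have g0 w : (0 <= g w)%E by apply: le_trans (fg w).
rewrite !ge0_integralTE //; apply: le_ereal_sup => _ [h hf <-]; exists h => // w.
exact: le_trans (hf w) (fg w).
Qed.

Lemma integral_partition (R : realType) d (T : measurableType d) (P : probability T R)
    (J : finType) (E : J -> set T) (c : J -> R) :
  (forall j, measurable (E j)) -> (forall j, 0 <= c j) ->
  (\int[P]_w (\sum_j c j * \1_(E j) w)%:E = \sum_j (c j)%:E * P (E j))%E.
Proof.
move=> mE c0; under eq_integral do rewrite -sumEFin.
rewrite ge0_integral_sum //.
- apply: eq_bigr => j _; rewrite (integralZl_indic measurableT (fun=> E j)) //.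
    by rewrite integral_indic // setIT.
  by rewrite ltNge => /negP; rewrite c0.
- move=> j; apply/measurable_EFinP; apply: measurable_funM => //.
- by move=> j w _; rewrite lee_fin mulr_ge0.
Qed.

(** [S] is squeezed between the step functions [max 0 (c - e)] and [c + e] of the label; truncation
    at 0 keeps the lower one within reach of [ge0_le_integralT]. *)
Lemma expectation_partition (R : realType) d (T : measurableType d) (P : probability T R)
    (J : finType) (E : J -> set T) (lab : T -> J) (q : R) (c : J -> R) (S : T -> R) (e : R) :
  (forall j, measurable (E j)) -> (forall w j, E j w <-> lab w = j) ->
  (forall j, P (E j) = q%:E) -> (forall j, 0 <= c j) -> (forall w, 0 <= S w) ->
  (forall w, `|S w - c (lab w)| <= e) ->
  ((\sum_j c j * q - e)%:E <= 'E_P[S] <= (\sum_j c j * q + e)%:E)%E.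
Proof.
move=> mE Elab PE c0 S0 Se.
have sumE (b : J -> R) w : \sum_j b j * \1_(E j) w = b (lab w).
  rewrite (bigD1 (lab w)) //= indicE mem_set ?mulr1; last exact/Elab.
  rewrite big1 ?addr0 // => j /eqP jw; rewrite indicE memNset ?mulr0 //.
  by move=> /Elab/esym/jw.
have sumq : \sum_(j : J) q = 1.
  have := @integral_partition R d T P J E (fun=> 1) mE (fun=> ler01).
  under eq_integral do rewrite sumE.
  rewrite integral_cst // (_ : _ [set: T] = 1%E) ?mule1; last exact: probability_setT.
  under eq_bigr do rewrite PE mul1e.
  by rewrite sumEFin => -[].
have int (b : J -> R) : (forall j, 0 <= b j) -> (\int[P]_w (b (lab w))%:E = (\sum_j b j * q)%:E)%E.
  move=> b0; under eq_integral do rewrite -sumE.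
  rewrite integral_partition //; under eq_bigr do rewrite PE.
  by rewrite -sumEFin.
have e0 (w : T) : 0 <= e by apply: le_trans (Se w).
have -> : ('E_P[S] = \int[P]_w (S w)%:E)%E by rewrite unlock.
apply/andP; split.
  apply: (@le_trans _ _ (\int[P]_w (Num.max 0 (c (lab w) - e))%:E)%E).
    rewrite (int (fun j => Num.max 0 (c j - e))); last by move=> j; rewrite le_max lexx.
    have -> : \sum_j c j * q - e = \sum_j (c j - e) * q.
      by under [RHS]eq_bigr do rewrite mulrBl; rewrite sumrB -mulr_sumr sumq mulr1.
    rewrite lee_fin; apply: ler_sum => j _; rewrite ler_wpM2r ?le_max ?lexx ?orbT //.
    by rewrite -lee_fin -(PE j).
  apply: ge0_le_integralT => w; rewrite lee_fin ?le_max ?lexx // ge_max S0 /=.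
  by have := Se w; rewrite ler_norml => /andP[+ _]; rewrite lerBrDr addrC.
apply: (@le_trans _ _ (\int[P]_w (c (lab w) + e)%:E)%E).
  apply: ge0_le_integralT => w; rewrite lee_fin //.
  by have := Se w; rewrite ler_norml => /andP[_]; rewrite lerBlDl.
(* A space of total mass 1 is inhabited, which yields [0 <= e]. *)
have [[w _]|noT] := pselect (exists w : T, True); last first.
  have := probability_setT P; rewrite (_ : [set: T] = set0) ?measure0.
    by move=> [] /eqP; rewrite eq_sym oner_eq0.
  by apply/seteqP; split => // w _; apply: noT; exists w.
rewrite (int (fun j => c j + e)); last by move=> j; rewrite addr_ge0 // e0.
have -> : \sum_j (c j + e) * q = \sum_j c j * q + e; last by [].
by under eq_bigr do rewrite mulrDl; rewrite big_split /= -mulr_sumr sumq mulr1.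
Qed.

(** The number exp(pi i / M); its powers are the initial points of the arcs. *)
Definition omega (R : realType) M : R[i] := (cos (pi / M%:R) +i* sin (pi / M%:R))%C.

Lemma omegaX (R : realType) M i :
  omega R M ^+ i = (cos (i%:R * (pi / M%:R)) +i* sin (i%:R * (pi / M%:R)))%C.
Proof.
rewrite /omega; move: (pi / M%:R) => t; elim: i => [|i IH].
  by rewrite mul0r cos0 sin0.
rewrite exprS IH -[i.+1]addn1 natrD [(_ + 1) * t]mulrDl mul1r addrC cosD sinD.
by apply/eqP; rewrite eq_complex /=; apply/andP; split; apply/eqP; ring.
Qed.

Lemma omega_prim (R : realType) M : (0 < M)%N -> (2 * M).-primitive_root (omega R M).
Proof.
move=> M0; rewrite /primitive_root_of_unity muln_gt0 M0 /=; apply/forallP => -[i iM].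
rewrite unity_rootE omegaX /=; have pp := pi_gt0 R.
have Mp : 0 < M%:R :> R by rewrite ltr0n.
have [->|ne] := eqVneq i.+1 (2 * M)%N.
  have -> : (2 * M)%:R * (pi / M%:R) = pi *+ 2 :> R.
    by rewrite natrM -[RHS]mulr_natl -mulrA [M%:R * _]mulrC divfK // gt_eqF.
  by rewrite cos2pi sin2pi (_ : (1 +i* 0)%C = 1 :> R[i]) // !eqxx.
apply/eqP/negbTE/eqP => -[c1 s0].
have th : 0 < i.+1%:R * (pi / M%:R : R) < 2 * pi.
  have lt2 : i.+1%:R < (2 * M)%:R :> R by rewrite ltr_nat ltn_neqAle ne.
  have q0 : 0 < pi / M%:R :> R by exact: divr_gt0.
  apply/andP; split; first by apply: mulr_gt0.
  have -> : 2 * pi = (2 * M)%:R * (pi / M%:R) :> R.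
    by rewrite natrM -mulrA; congr (_ * _); rewrite mulrC divfK // gt_eqF.
  by rewrite ltr_pM2r.
have /andP[th0 th2] := th.
have := @angleK R (i.+1%:R * (pi / M%:R)); rewrite c1 s0 (ltW th0) th2 /angle /= lexx acos1.
by move=> /(_ isT) h; rewrite -h ltxx in th0.
Qed.

(** * Modulus estimates and perturbation of multiplicative functions *)

Lemma cmod_ge0 (R : realType) (z : R[i]) : 0 <= cmod z.
Proof. by case: z => a b; rewrite /cmod /= sqrtr_ge0. Qed.

Lemma cmodM (R : realType) (y z : R[i]) : cmod (y * z) = cmod y * cmod z.
Proof. exact: ComplexField.Normc.normcM. Qed.

Lemma cmodD (R : realType) (y z : R[i]) : cmod (y + z) <= cmod y + cmod z.
Proof. exact: le_normcD. Qed.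

Lemma cmod0 (R : realType) : cmod (0 : R[i]) = 0.
Proof. exact: ComplexField.Normc.normc0. Qed.

Lemma cmodN (R : realType) (z : R[i]) : cmod (- z) = cmod z.
Proof. exact: normcN. Qed.

Lemma cmod_sum (R : realType) (I : Type) (r : seq I) (P : pred I) (F : I -> R[i]) :
  cmod (\sum_(i <- r | P i) F i) <= \sum_(i <- r | P i) cmod (F i).
Proof.
elim/big_rec2: _ => [|i a b _ ab]; first by rewrite cmod0.
by apply: le_trans (cmodD _ _) _; rewrite lerD2l.
Qed.

Lemma cmod_Re_Im (R : realType) (a b : R) : cmod (a +i* b)%C <= `|a| + `|b|.
Proof.
rewrite /cmod /= -[leRHS]ger0_norm ?addr_ge0 // -sqrtr_sqr ler_wsqrtr //.
rewrite -(real_normK (num_real a)) -(real_normK (num_real b)).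
by have := normr_ge0 a; have := normr_ge0 b; nra.
Qed.

Lemma cmod_real (R : realType) (a : R) : cmod (a%:C)%C = `|a|.
Proof. by rewrite /cmod /= expr0n /= addr0 sqrtr_sqr. Qed.

Lemma cmod_omega (R : realType) M : cmod (omega R M) = 1.
Proof. by rewrite /cmod /= cos2Dsin2 sqrtr1. Qed.

Lemma cmod_root_cmul (R : realType) N M K (j : {ffun small_prime N -> 'I_M}) n :
  cmod (root_cmul (omega R K) j n) = 1.
Proof.
rewrite /root_cmul; elim/big_ind: _ => [|y z hy hz|p _].
- exact: ComplexField.Normc.normc1.
- by rewrite cmodM hy hz mulr1.
- elim: (_ * _)%N => [|m IH]; first exact: ComplexField.Normc.normc1.
  by rewrite exprS cmodM cmod_omega IH mulr1.
Qed.

(** Induction on [n], splitting off its least prime factor: for unimodular values each prime factor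
    adds at most [e], and n / p + 1 <= n. *)
Lemma unimodular_close (R : realType) N M K (f : nat -> R[i])
    (j : {ffun small_prime N -> 'I_M}) (e : R) : unimodular_cmul N f -> 0 <= e ->
  (forall p : small_prime N, cmod (f (spval p) - omega R K ^+ j p) <= e) ->
  forall n, (0 < n <= N)%N -> cmod (f n - root_cmul (omega R K) j n) <= n%:R * e.
Proof.
move=> [f1 fM] e0 fe; elim/ltn_ind => n IH /andP[n0 nN].
have [n1|n1] := leqP n 1.
  have -> : n = 1%N by lia.
  have fe1 : f 1%N = 1.
    have f0 : f 1%N != 0.
      apply/eqP => f0; have := f1 1%N; rewrite f0 cmod0 => /(_ _).
      by move=> /(_ (leq_trans n0 nN)) /eqP; rewrite eq_sym oner_eq0.
    by apply: (mulfI f0); rewrite mulr1 -(fM 1%N 1%N) // (leq_trans n0 nN).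
  by rewrite root_cmul1 fe1 subrr cmod0 mul1r.
have pp := pdiv_prime n1; set p := pdiv n in pp.
have nE : n = (p * (n %/ p))%N by rewrite mulnC divnK // pdiv_dvd.
set m := (n %/ p)%N in nE.
have m0 : (0 < m)%N by move: n0; rewrite nE muln_gt0 => /andP[].
have p2 : (2 <= p)%N := prime_gt1 pp.
have mn : (m.+1 <= n)%N by rewrite nE; nia.
have pN : (p < N.+1)%N by rewrite ltnS (leq_trans _ nN) // nE leq_pmulr.
pose sp : small_prime N := Sub (Ordinal pN) pp.
have spE : spval sp = p by [].
have hp := fe sp; rewrite spE in hp.
have hm : cmod (f m - root_cmul (omega R K) j m) <= m%:R * e.
  by apply: IH => //; rewrite m0 (leq_trans _ nN) // ltnW.
have p0 := prime_gt0 pp.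
have fE : f n = f p * f m by rewrite -fM // -nE.
have FE : root_cmul (omega R K) j n = omega R K ^+ j sp * root_cmul (omega R K) j m.
  by rewrite nE root_cmulM // -{1}spE root_cmul_prime.
rewrite fE FE.
have -> : f p * f m - omega R K ^+ j sp * root_cmul (omega R K) j m =
  f p * (f m - root_cmul (omega R K) j m) + (f p - omega R K ^+ j sp) * root_cmul (omega R K) j m.
  by rewrite mulrBr mulrBl addrA subrK.
apply: le_trans (cmodD _ _) _; rewrite !cmodM cmod_root_cmul mulr1 f1 ?mul1r ?p0 //.
apply: le_trans (lerD hm hp) _; rewrite -[X in _ + X]mul1r -mulrDl ler_wpM2r // natr1 ler_nat.
exact: mn.
Qed.

Lemma pow_close (R : realFieldType) (a b h : R) m : 0 <= a <= h -> 0 <= b <= h ->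
  `|a ^+ m - b ^+ m| <= `|a - b| * (m%:R * h ^+ m.-1).
Proof.
move=> /andP[a0 ah] /andP[b0 bh]; rewrite subrXX normrM ler_wpM2l //.
apply: le_trans (ler_norm_sum _ _ _) _.
apply: (@le_trans _ _ (\sum_(i < m) h ^+ m.-1)); last first.
  by rewrite sumr_const card_ord mulr_natl.
apply: ler_sum => i _; rewrite ger0_norm ?mulr_ge0 ?exprn_ge0 //.
have -> : h ^+ m.-1 = h ^+ (m.-1 - i) * h ^+ i.
  by rewrite -exprD subnK //; have := ltn_ord i; lia.
by apply: ler_pM; rewrite ?exprn_ge0 //; apply: lerXn2r; rewrite ?nnegrE //; apply: le_trans ah.
Qed.

Lemma root_cmul_cmod_moment (R : realType) x H k M : (0 < M)%N -> ((x + H) ^ k < 2 * M)%N ->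
  \sum_(j : {ffun small_prime (x + H) -> 'I_(2 * M)})
    cmod (\sum_(x.+1 <= n < (x + H).+1) root_cmul (omega R M) j n) ^+ (2 * k) =
  ((2 * M) ^ #|{: small_prime (x + H)}|)%:R * #|@solution x H k|%:R.
Proof.
move=> M0 kM; have := root_cmul_moment (omega_prim R M0) kM.
have cE (z : R[i]) : (z * z^*) ^+ k = (cmod z ^+ (2 * k))%:C%C.
  by rewrite -normCK exprM rmorphXn rmorphXn.
under eq_bigr do rewrite cE.
by rewrite -rmorph_sum -!natrM -(rmorph_nat (real_complex R)) => /complexI.
Qed.

Lemma cmod1_unit (R : realType) (z : R[i]) : cmod z = 1 ->
  (complex_pair z).1 ^+ 2 + (complex_pair z).2 ^+ 2 = 1.
Proof.
case: z => a b; rewrite /cmod /complex_pair /= => h.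
by rewrite -(sqr_sqrtr (_ : 0 <= a ^+ 2 + b ^+ 2)) ?h ?expr1n // addr_ge0 ?sqr_ge0.
Qed.

(** * Equiprobability of the arc configurations *)

Lemma steinhaus_prime (R : realType) d (T : measurableType d) (P : probability T R) N f
    (p : small_prime N) : steinhaus P N f ->
  [/\ is_complex_rv (fun w => f w (spval p)), uniform_on_circle P (fun w => f w (spval p))
    & forall w, cmod (f w (spval p)) = 1].
Proof.
move=> [fc fm fu _].
have pN : spval p \in [pred q : nat | prime q && (q <= N)%N].
  by rewrite inE (valP p) /= -ltnS ltn_ord.
split; [exact: fm|exact: fu|move=> w].
apply: (fc w).1; rewrite (prime_gt0 (valP p)) /= -ltnS; exact: ltn_ord.
Qed.

(** The disjoint arcs cover the circle and each has probability at least 1/(2M); the excesses are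
    nonnegative with sum 0, so they vanish. *)
Lemma steinhaus_arc (R : realType) d (T : measurableType d) (P : probability T R) N f M
    (p : small_prime N) (i : 'I_(2 * M)) : (0 < M)%N -> steinhaus P N f ->
  measurable [set w | circle_arc M i (complex_pair (f w (spval p)))] /\
  P [set w | circle_arc M i (complex_pair (f w (spval p)))] = ((2 * M)%:R^-1)%:E.
Proof.
move=> M0 /(steinhaus_prime p)[fm fu f1].
pose B (i : 'I_(2 * M)) := [set w | circle_arc M i (complex_pair (f w (spval p)))].
have mB j : measurable (B j).
  rewrite -[B j]setTI; apply: (fm measurableT); exact: measurable_arc.
split; first exact: mB.
have geB j : (((2 * M)%:R^-1)%:E <= P (B j))%E.
  by rewrite /B fu; [exact: lebesgue_arc_ge|exact: measurable_arc].
have BT : \big[setU/set0]_(j < 2 * M) B j = [set: T].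
  apply/seteqP; split => // w _.
  have [j Bj] := arc_cover M0 (cmod1_unit (f1 w)).
  by rewrite (bigD1 j) //=; left.
have tB : trivIset setT B.
  by apply/trivIsetP => a b _ _ ab; apply/seteqP; split => // w [wa wb];
    case/eqP: ab; apply/val_inj; exact: arc_disjoint wa wb.
have sB : \sum_(j < 2 * M) fine (P (B j)) = 1.
  apply/EFin_inj; rewrite -sumEFin; under eq_bigr do rewrite fineK ?fin_num_measure //.
  rewrite -(measure_bigsetU_ord _ xpredT) // BT; exact: probability_setT.
have gB j : (2 * M)%:R^-1 <= fine (P (B j)).
  by rewrite -lee_fin fineK ?fin_num_measure.
have : fine (P (B i)) - (2 * M)%:R^-1 = 0.
  apply/eqP; move: (erefl true).
  have s0 : \sum_(j < 2 * M) (fine (P (B j)) - (2 * M)%:R^-1) == 0.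
    rewrite sumrB sB sumr_const card_ord -[_ *+ (2 * M)]mulr_natr mulVf ?subrr //.
    by rewrite pnatr_eq0 muln_eq0 /= -lt0n.
  move: s0; rewrite psumr_eq0 => [/allP/(_ i)|j _]; last by rewrite subr_ge0.
  by rewrite mem_index_enum => /(_ isT) /= ->.
by move/eqP; rewrite subr_eq0 => /eqP <-; rewrite fineK ?fin_num_measure.
Qed.

Definition atom (R : realType) (T : Type) N M (f : T -> nat -> R[i])
    (j : {ffun small_prime N -> 'I_(2 * M)}) : set T :=
  [set w | forall p, circle_arc M (j p) (complex_pair (f w (spval p)))].

Lemma measurable_atom (R : realType) d (T : measurableType d) (P : probability T R) N f M
    (j : {ffun small_prime N -> 'I_(2 * M)}) : (0 < M)%N -> steinhaus P N f ->
  measurable (atom f j).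
Proof.
move=> M0 sf.
have -> : atom f j = \bigcap_(p in [set: small_prime N])
    [set w | circle_arc M (j p) (complex_pair (f w (spval p)))].
  by apply/seteqP; split => w /= h p => [_|]; apply: h.
apply: fin_bigcap_measurable => [|p _]; first exact: finite_finset.
exact: (steinhaus_arc p (j p) M0 sf).1.
Qed.

Lemma probability_atom (R : realType) d (T : measurableType d) (P : probability T R) N f M
    (j : {ffun small_prime N -> 'I_(2 * M)}) : (0 < M)%N -> steinhaus P N f ->
  P (atom f j) = ((2 * M)%:R^-1 ^+ #|{: small_prime N}|)%:E.
Proof.
move=> M0 sf; have [_ _ _ ind] := sf.
(* Independence takes sets indexed by all naturals; the whole plane is the default away from primes
   up to [N]. *)
pose A (n : nat) : set (R * R) :=
  if (insub n : option 'I_N.+1) is Some q then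
    if (insub q : option (small_prime N)) is Some p then circle_arc M (j p) else setT
  else setT.
have AE (p : small_prime N) : A (spval p) = circle_arc M (j p) by rewrite /A /spval !valK.
pose J := [seq spval p | p <- enum {: small_prime N}].
have := ind J A.
have -> : [set w | forall n, n \in J -> A n (complex_pair (f w n))] = atom f j.
  apply/seteqP; split => w /= h.
    by move=> p; rewrite -AE; apply: h; apply: map_f; rewrite mem_enum.
  by move=> n /mapP[p _ ->]; rewrite AE.
move=> -> //.
- rewrite big_map big_enum /=.
  under eq_bigr => p _ do rewrite AE (steinhaus_arc p (j p) M0 sf).2.
  by rewrite prodEFin prodr_const.
- rewrite map_inj_uniq ?enum_uniq // => p q pq; apply/val_inj/val_inj; exact: pq.
- by move=> n /mapP[p _ ->]; rewrite inE (valP p) /= -ltnS ltn_ord.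
- move=> n; rewrite /A; case: insub => [q|] //; case: insub => [p|] //; exact: measurable_arc.
Qed.

(** The two sums differ by at most [H * (x + H) * e] and have modulus at most [H], where the power
    map is Lipschitz by [pow_close]. *)
Lemma moment_diff (R : realType) x H k (g h : nat -> R[i]) (e : R) : (0 < H)%N -> 0 <= e ->
  (forall n, (0 < n <= x + H)%N -> cmod (g n) = 1) ->
  (forall n, (0 < n <= x + H)%N -> cmod (h n) = 1) ->
  (forall n, (0 < n <= x + H)%N -> cmod (g n - h n) <= n%:R * e) ->
  `|cmod (\sum_(x.+1 <= n < (x + H).+1) g n) ^+ k - cmod (\sum_(x.+1 <= n < (x + H).+1) h n) ^+ k|
  <= H%:R * (x + H)%:R * (k%:R * H%:R ^+ k.-1) * e.
Proof.
move=> H0 e0 g1 h1 gh.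
have rg n : (x.+1 <= n < (x + H).+1)%N -> (0 < n <= x + H)%N.
  by rewrite ltnS => /andP[n1 ->]; rewrite (leq_ltn_trans (leq0n x) n1).
have sH (c : R) : \sum_(x.+1 <= n < (x + H).+1) c = H%:R * c.
  by rewrite big_const_nat iter_addr_0 subSS addKn mulr_natl.
have b1 (u : nat -> R[i]) : (forall n, (0 < n <= x + H)%N -> cmod (u n) = 1) ->
    0 <= cmod (\sum_(x.+1 <= n < (x + H).+1) u n) <= H%:R.
  move=> u1; rewrite cmod_ge0 /=; apply: le_trans (cmod_sum _ _ _) _.
  by rewrite -[leRHS]mulr1 -sH; apply: ler_sum_nat => n /rg/u1 ->.
apply: le_trans (pow_close k (b1 g g1) (b1 h h1)) _.
rewrite [leRHS]mulrAC; apply: ler_wpM2r; first by rewrite mulr_ge0 ?exprn_ge0.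
set a := \sum_(_ <= _ < _) g _; set b := \sum_(_ <= _ < _) h _.
have ab : cmod (a - b) <= H%:R * (x + H)%:R * e.
  rewrite /a /b -sumrB; apply: le_trans (cmod_sum _ _ _) _.
  rewrite -mulrA -sH; apply: ler_sum_nat => n /rg n1; apply: le_trans (gh n n1) _.
  by rewrite ler_wpM2r // ler_nat; case/andP: n1.
apply: le_trans ab; rewrite ler_norml; apply/andP; split.
  rewrite lerNl opprB lerBlDr -(cmodN (a - b)) opprB; apply: le_trans (cmodD _ _).
  by rewrite subrK.
by rewrite lerBlDr; apply: le_trans (cmodD _ _); rewrite subrK.
Qed.

(** Discretization shows the expectation to be within [D / M] of the count for every large [M];
    equality follows as [M] grows. *)
Lemma steinhaus_moment (R : realType) d (T : measurableType d) (P : probability T R) x H k f :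
  (0 < x)%N -> (0 < H)%N -> steinhaus P (x + H) f ->
  ('E_P[fun w => (cmod ((Num.sqrt (H%:R : R))^-1%:C%C
      * \sum_(x.+1 <= n < (x + H).+1) f w n) ^+ (2 * k))%R]
   = (#|@solution x H k|%:R / H%:R ^+ k)%:E)%E.
Proof.
move=> x0 H0 sf; have Hp : 0 < H%:R :> R by rewrite ltr0n.
have pp := pi_gt0 R.
(* The constant of [moment_diff] for exponent [2 * k] and [e = 2 * pi / M], without the factor 1/M;
   real and imaginary parts contribute [pi / M] each. *)
pose D : R := H%:R * (x + H)%:R * ((2 * k)%:R * H%:R ^+ (2 * k).-1) * (2 * pi).
have D0 : 0 <= D by rewrite !mulr_ge0 ?exprn_ge0 // ltW.
pose v : R := #|@solution x H k|%:R / H%:R ^+ k.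
set S := (fun w => _).
have scale (z : R[i]) : cmod ((Num.sqrt (H%:R : R))^-1%:C%C * z) ^+ (2 * k) = cmod z ^+ (2 * k) / H%:R ^+ k.
  rewrite cmodM cmod_real ger0_norm ?invr_ge0 ?sqrtr_ge0 // exprMn mulrC; congr (_ * _).
  by rewrite exprM exprVn sqr_sqrtr // exprVn.
have step M : (0 < M)%N -> ((x + H) ^ k < 2 * M)%N ->
    ((v - D / M%:R)%:E <= 'E_P[S] <= (v + D / M%:R)%:E)%E.
  move=> M0 kM; have Mp : 0 < M%:R :> R by rewrite ltr0n.
  have labex w : exists j : {ffun small_prime (x + H) -> 'I_(2 * M)}, atom f j w.
    have /choice[g hg] (p : small_prime (x + H)) : exists i : 'I_(2 * M),
        circle_arc M i (complex_pair (f w (spval p))).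
      have [_ _ f1] := steinhaus_prime p sf.
      by apply: arc_cover => //; apply: cmod1_unit.
    by exists [ffun p => g p] => p; rewrite ffunE.
  have [lab hlab] := choice labex.
  pose c (j : {ffun small_prime (x + H) -> 'I_(2 * M)}) : R :=
    cmod (\sum_(x.+1 <= n < (x + H).+1) root_cmul (omega R M) j n) ^+ (2 * k) / H%:R ^+ k.
  have vE : v = \sum_j c j * ((2 * M)%:R^-1 ^+ #|{: small_prime (x + H)}|).
    rewrite -mulr_suml -mulr_suml root_cmul_cmod_moment // /v natrX exprVn mulrAC.
    by congr (_ / _); rewrite mulrAC mulfV ?mul1r // expf_neq0 // pnatr_eq0 muln_eq0 /= -lt0n.
  rewrite vE; apply: (@expectation_partition _ _ _ _ _ (@atom R T (x + H) M f) lab) => //.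
  - by move=> j; apply: measurable_atom sf.
  - move=> w j; split => [wj|<-]; last exact: hlab.
    by apply/ffunP => p; apply/val_inj; exact: arc_disjoint (hlab w p) (wj p).
  - by move=> j; apply: probability_atom sf.
  - by move=> j; rewrite divr_ge0 ?exprn_ge0 ?cmod_ge0.
  - by move=> w; rewrite exprn_ge0 ?cmod_ge0.
  move=> w; rewrite /S scale /c -mulrBl normrM.
  have [fc _ _ _] := sf.
  have e0 : 0 <= 2 * pi / M%:R :> R by rewrite divr_ge0 // mulr_ge0 // ltW.
  have ce n : (0 < n <= x + H)%N ->
      cmod (f w n - root_cmul (omega R M) (lab w) n) <= n%:R * (2 * pi / M%:R).
    apply: (unimodular_close (fc w) e0) => p.
    have [_ _ /(_ w)/cmod1_unit f1] := steinhaus_prime p sf.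
    have [h1 h2] := arc_close M0 f1 (hlab w p).
    rewrite omegaX; case: (f w (spval p)) h1 h2 => a b /= h1 h2.
    apply: le_trans (cmod_Re_Im _ _) _; apply: le_trans (lerD h1 h2) _.
    by move: (pi : R) => q; rewrite -mulrDl mulr_natl mulr2n.
  have := @moment_diff R x H (2 * k) (f w) (root_cmul (omega R M) (lab w)) _ H0 e0 (fc w).1
    (fun n _ => cmod_root_cmul R M (lab w) n) ce.
  rewrite [in leRHS]mulrA -/D => md; apply: le_trans md.
  rewrite ler_piMr // normfV ger0_norm ?exprn_ge0 // invf_le1 ?exprn_gt0 //.
  by rewrite exprn_ege1 // ler1n.
have big (e : R) : 0 < e -> exists M, [/\ (0 < M)%N, ((x + H) ^ k < 2 * M)%N & D / M%:R <= e].
  (* The first entry keeps orthogonality exact, the second exceeds [D / e]. *)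
  move=> e0; exists (maxn ((x + H) ^ k).+1 (Num.truncn (D / e)).+1).
  set M := maxn _ _.
  have M1 : (((x + H) ^ k).+1 <= M)%N := leq_maxl _ _.
  have M2 : ((Num.truncn (D / e)).+1 <= M)%N := leq_maxr _ _.
  have M0 : (0 < M)%N by apply: leq_trans M2.
  split => //; first by lia.
  rewrite ler_pdivrMr ?ltr0n // mulrC -ler_pdivrMr //.
  have /andP[_ h] := truncn_itv (divr_ge0 D0 (ltW e0)).
  by apply: (le_trans (ltW h)); rewrite ler_nat.
apply/eqP; rewrite eq_le; apply/andP; split; apply/lee_addgt0Pr => e e0.
  have [M [M0 kM De]] := big e e0; have /andP[_ h] := step M M0 kM.
  by apply: le_trans h _; rewrite -EFinD lee_fin lerD2l.
have [M [M0 kM De]] := big e e0; have /andP[h _] := step M M0 kM.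
rewrite -leeBlDr //; apply: le_trans h; rewrite -EFinB lee_fin lerD2l lerN2 //.
Qed.

Theorem theorem1p2 (R : realType) (k : nat) (hk : (1 <= k)%N) :
  exists C : R, 0 < C /\
    forall (x H : nat), (1 <= x)%N -> (1 <= H)%N ->
    forall (d : measure_display) (T : measurableType d) (P : probability T R)
      (f : T -> nat -> R[i]),
      steinhaus P (x + H) f ->
      (`| 'E_P[fun w : T =>
             (cmod ((Num.sqrt (H%:R : R))^-1%:C%C
                   * \sum_(x.+1 <= n < (x + H).+1) f w n) ^+ (2 * k))%R]
          - (k`!%:R : R)%:E |
       <= (C * error_term R x H k)%:E)%E.
Proof.
have [C [C0 hC]] := solution_count R hk.
exists C; split => // x H x1 H1 d T P f sf.
by rewrite (steinhaus_moment k x1 H1 sf) lee_fin hC.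
Qed.
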